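(* Let $k \ge 1$ and $r$ be integers with $0 \le r < k$, and let $\mathbf{v} \in V_r \setminus \{\mathbf{0}\}$, where $V_r \subseteq \mathbb{R}^{k!}$ is the span of the matrix elements of the simple representations $\rho^\lambda$ of $S_k$ with $\lambda \vdash k$, $\lambda_1 = k-r$. Let $\mathbf{P}_{kn}$ be the $k$-profile of a uniformly random permutation in $S_n$. Then there exists a constant $C_{\mathbf{v}} > 0$ (not depending on $n$) such that, as $n \to \infty$, $$ E\left[\, \langle \mathbf{v}, \mathbf{P}_{kn} \rangle^2 \,\right] \;\sim\; \frac{C_{\mathbf{v}}}{n^r}. $$
   Context: **Patterns and profiles.** For $\pi \in S_n$, $k \le n$ and positions $a_1 < \dots < a_k$ in $\{1,\dots,n\}$, the pattern induced by $\pi$ at these positions is the unique $\sigma \in S_k$ with $\sigma(i)<\sigma(j) \iff \pi(a_i)<\pi(a_j)$ for all $i,j$. For $\sigma \in S_k$, $N_\sigma(\pi)$ is the number of $k$-subsets of positions at which $\pi$ induces $\sigma$, and the density of $\sigma$ in $\pi$ is $P_\sigma(\pi) = N_\sigma(\pi)/\binom{n}{k}$. The $k$-profile of $\pi$ is the vector $\mathbf{P}_k(\pi) = (P_\sigma(\pi))_{\sigma \in S_k} \in \mathbb{R}^{k!}$, where $\mathbb{R}^{k!}$ has coordinates indexed by $S_k$. For $\pi$ uniformly distributed in $S_n$, the random vector $\mathbf{P}_k(\pi)$ is denoted $\mathbf{P}_{kn}$ (for $n \ge k$). **Inner product.** $\langle \mathbf{u},\mathbf{v}\rangle = \sum_{\sigma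 \in S_k} u_\sigma v_\sigma$ on $\mathbb{R}^{k!}$. **Representations and the subspaces $V_r$.** A partition $\lambda \vdash k$ is a nonincreasing sequence of positive integers $\lambda_1 \ge \dots \ge \lambda_\ell \ge 1$ with sum $k$. For each $\lambda \vdash k$, $\rho^\lambda$ is the corresponding simple (irreducible) real representation of $S_k$, defined up to similarity: the left action of $S_k$ on $A c_\lambda$, where $A = \mathbb{R}S_k$ is the group algebra and $c_\lambda = \left(\sum_{\sigma \in P_T} \sigma\right)\left(\sum_{\sigma \in Q_T} \mathrm{sign}(\sigma)\sigma\right)$ is the Young symmetrizer of any tableau $T$ of shape $\lambda$ (a filling of the Young diagram of $\lambda$, with row lengths $\lambda_i$, by $1,\dots,k$, each once), $P_T$ and $Q_T$ being the subgroups of permutations preserving each row, respectively each column, of $T$. Thus $\lambda=(k)$ gives the trivial representation and $\lambda = (1,\dots,1)$ the sign representation. Let $d_\lambda = \dim \rho^\lambda$. If $\rho^\lambda$ is given by real matrices $R^\lambda(\sigma) \in \mathbb{R}^{d_\lambda\times d_\lambda}$, $\sigma \in S_k$, its matrix elements are the vectors $\mathbf{R}^\lambda_{ij} = (R^\lambda_{ij}(\sigma))_{\sigma \in S_k} \in \mathbb{R}^{k!}$, $1 \le i,j \le d_\lambda$; their span does not depend on the choice of matrices. For $r \in \{0,\dots,k-1\}$, $$V_r := \mathrm{span}\{\mathbf{R}^\lambda_{ij} : \lambda \vdash k,\ \lambda_1 = k-r,\ 1\le i,j\le d_\lambda\}.$$ **Asymptotics.** $a_n \sim b_n$ means $a_n/b_n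 \to 1$ as $n\to\infty$. *)

(* Defs.v *)
(* MathComp / MathComp-Analysis *)
From HB Require Import structures.
From mathcomp Require Import all_boot all_order all_algebra.
From mathcomp Require Import all_fingroup mxrepresentation.
From mathcomp Require Import classical_sets reals topology normedtype sequences.

Set Implicit Arguments.
Unset Strict Implicit.
Unset Printing Implicit Defensive.

Import Order.TTheory GRing.Theory Num.Theory.
Import numFieldNormedType.Exports.

Local Open Scope ring_scope.

(* Positions and values are numbered from 0: [n] is 'I_n. *)

Definition induces (n k : nat) (pi : 'S_n) (a : {ffun 'I_k -> 'I_n})
    (sigma : 'S_k) : bool :=
  [forall i : 'I_k, forall j : 'I_k, (sigma i < sigma j)%N == (pi (a i) < pi (a j))%N].

Definition increasing (n k : nat) (a : {ffun 'I_k -> 'I_n}) : bool :=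
  [forall i : 'I_k, forall j : 'I_k, (i < j)%N ==> (a i < a j)%N].

(* The k-subset A is listed in increasing order by a. *)
Definition pattern_count (n k : nat) (sigma : 'S_k) (pi : 'S_n) : nat :=
  #|[set A : {set 'I_n} | [exists a : {ffun 'I_k -> 'I_n},
      [&& increasing a, A == [set a i | i : 'I_k] & induces pi a sigma]]]|.

Definition pattern_density (R : realType) (n k : nat) (sigma : 'S_k)
    (pi : 'S_n) : R :=
  (pattern_count sigma pi)%:R / ('C(n, k))%:R.

(* The space R^{k!}; the regular algebra R^o makes it a vectType over R. *)
Notation permvec R k := {ffun 'S_k -> R^o}.

Definition profile (R : realType) (k n : nat) (pi : 'S_n) : permvec R k :=
  [ffun sigma : 'S_k => pattern_density R sigma pi].

Definition inner (R : realType) (k : nat) (u v : permvec R k) : R :=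
  \sum_(sigma : 'S_k) u sigma * v sigma.

Definition unif_expectation (R : realType) (n : nat) (X : 'S_n -> R) : R :=
  (\sum_(pi : 'S_n) X pi) / #|{: 'S_n}|%:R.

Definition is_partition (k : nat) (lam : seq nat) : bool :=
  [&& sorted geq lam, all (fun m => 0 < m)%N lam & sumn lam == k].

(* A tableau is the list of its rows. *)
Definition is_tableau (k : nat) (lam : seq nat) (T : seq (seq 'I_k)) : bool :=
  (shape T == lam) && perm_eq (flatten T) (enum 'I_k).

Definition row_of (k : nat) (T : seq (seq 'I_k)) (x : 'I_k) : nat :=
  find (fun s => x \in s) T.

Definition col_of (k : nat) (T : seq (seq 'I_k)) (x : 'I_k) : nat :=
  index x (nth [::] T (row_of T x)).

Definition row_stab (k : nat) (T : seq (seq 'I_k)) : {set 'S_k} :=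
  [set s : 'S_k | [forall x, row_of T (s x) == row_of T x]].

Definition col_stab (k : nat) (T : seq (seq 'I_k)) : {set 'S_k} :=
  [set s : 'S_k | [forall x, col_of T (s x) == col_of T x]].

(* In 'S_k the product s * t is t \o s (s acts first), opposite to the
   composition of functions, and a representation acts on row vectors from the
   right. Left multiplication by s for composition is thus right multiplication
   by s in 'S_k, i.e. the regular representation below; the left ideal A c_T
   becomes the right ideal c_T A, and the two factors of the Young symmetrizer
   c_T appear in reverse order. The matrices obtained are the transposes of
   those of the left action on columns. *)
Definition young_symmetrizer (R : realType) (k : nat) (T : seq (seq 'I_k)) :
    'rV[R]_#|[set: 'S_k]| :=
  let reg := regular_repr R [set: 'S_k]%G in
  gring_row ((\sum_(q in col_stab T) (-1) ^+ odd_perm q *: reg q)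
             *m (\sum_(p in row_stab T) reg p)).

Definition specht_repr (R : realType) (k : nat) (T : seq (seq 'I_k)) :=
  submod_repr
    (cyclic_mx_module (regular_repr R [set: 'S_k]%G) (young_symmetrizer R T)).

(* The matrix elements of all matrix forms of rho^lam. *)
Definition is_matrix_element (R : realType) (k : nat) (lam : seq nat)
    (w : permvec R k) : Prop :=
  exists (T : seq (seq 'I_k)) (d : nat)
         (rG : mx_representation R [set: 'S_k]%G d) (i j : 'I_d),
    [/\ is_tableau lam T, mx_rsim rG (specht_repr R T)
      & w = [ffun s : 'S_k => rG s i j]].

Definition lin_span (K : fieldType) (E : vectType K) (X : set E) : set E :=
  [set v | exists s : seq E, (forall w, w \in s -> X w) /\ v \in <<s>>%VS]%classic.

Definition Vspace (R : realType) (k r : nat) : set (permvec R k) :=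
  lin_span [set w : permvec R k | exists lam : seq nat,
    [/\ is_partition k lam, head 0%N lam = (k - r)%N
      & is_matrix_element lam w]]%classic.
Arguments Vspace : clear implicits.

Definition asymp_equiv (R : realType) (a b : nat -> R) : Prop :=
  ((fun n => a n / b n) @ \oo --> (1 : R))%classic.

(* Main.v *)
(* Replace pi by al^-1 * be with al, be independent uniform permutations: the
   labels 0, ..., n - 1 become points (al x, be x), and C(n,k) <v, P_k(pi)> is the
   sum over k-sets L of labels of v(pattern of L).  The expectation of the product
   of the terms of two k-sets depends only on the number m of common labels, say
   it is zeta_m, so that
     E <v, P_k>^2 = \sum_m zeta_m C(k,m) C(n-k,k-m) / C(n,k),
   whose m-th term has order n^-m.  It remains to see that zeta_m = 0 for m < r and
   zeta_r > 0 when v is a nonzero element of V_r.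
   Up to a positive factor, zeta_m is the value at (x, y) |-> v(x^-1 y) of K (x) K,
   where K(x, x') counts the orders of the 2k - m labels which induce x and x' on
   the two k-sets.  This is a number of shuffles of words, and K is an explicit Gram
   matrix sum_th L_th L_th^T, where the L_th span the functions on S_k invariant
   under the subgroup S_{k-m} permuting the labels that are not shared.  Hence
   zeta_m >= 0, with equality iff v sums to 0 over all sets x S_{k-m} y.
   Elements of V_r have this property for m < r because the column antisymmetrizer
   of a tableau kills the sum of a symmetric group on more points than there are
   columns.  They do not have it for m = r unless they vanish: the matrix elements
   are combinations of indicators of such sets, thanks to the factor of the Young
   symmetrizer that symmetrizes the first row. *)

Require Import Defs.
From mathcomp Require Import all_boot all_order all_algebra.
From mathcomp Require Import all_fingroup.
From mathcomp Require Import mxrepresentation ring.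
From mathcomp Require Import classical_sets reals topology normedtype sequences.

Set Implicit Arguments.
Unset Strict Implicit.
Unset Printing Implicit Defensive.

Import Order.TTheory GRing.Theory Num.Theory.
Import numFieldNormedType.Exports.
Local Open Scope ring_scope.

(** * Permutations and symmetric subgroups *)

(** Both lists are completed to enumerations of [T] by appending the missing elements; matching
    these position by position is a bijection. *)
Lemma exists_perm_map (T : finType) (s1 s2 : seq T) :
  uniq s1 -> uniq s2 -> size s1 = size s2 -> exists t : {perm T}, map t s1 = s2.
Proof.
move=> u1 u2 ss.
pose ext (s : seq T) := s ++ [seq x <- enum T | x \notin s].
have ext_mem s x : x \in ext s by rewrite mem_cat mem_filter mem_enum andbT orbN.
have ext_uniq s : uniq s -> uniq (ext s).
  move=> us; rewrite cat_uniq us filter_uniq ?enum_uniq // andbT.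
  by apply/hasPn => x; rewrite mem_filter => /andP[].
have ext_size s : uniq s -> size (ext s) = #|T|.
  move=> us; rewrite -(card_uniqP (ext_uniq s us)); apply: eq_card => x.
  by rewrite ext_mem.
pose f x := nth x (ext s2) (index x (ext s1)).
have idx x : (index x (ext s1) < size (ext s2))%N.
  by rewrite ext_size // -(ext_size _ u1) index_mem.
have f_inj : injective f.
  move=> x y; rewrite /f (set_nth_default y) // => /eqP.
  rewrite nth_uniq ?ext_uniq // => /eqP e.
  by rewrite -(nth_index x (ext_mem s1 x)) e nth_index.
exists (perm f_inj).
have [s10|[x0 _]] : s1 = [::] \/ exists x0, x0 \in s1.
- by case: (s1) => [|x0 s]; [left | right; exists x0; rewrite mem_head].
- by move: ss; rewrite s10; case: (s2).
apply: (@eq_from_nth _ x0) => [|i]; first by rewrite size_map.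
rewrite size_map => lti; rewrite (nth_map x0) // permE /f.
rewrite /ext index_cat mem_nth // index_uniq // nth_cat -ss lti.
by apply: set_nth_default; rewrite -ss.
Qed.

Lemma exists_perm_imset (T : finType) (Y Z : {set T}) :
  #|Y| = #|Z| -> exists t : {perm T}, Z = [set t x | x in Y].
Proof.
move=> cYZ; have [|||t tE] := @exists_perm_map T (enum Y) (enum Z).
- exact: enum_uniq.
- exact: enum_uniq.
- by rewrite -!cardE.
exists t; apply/setP => z; rewrite -mem_enum -tE.
by apply/mapP/imsetP => -[x]; rewrite ?mem_enum => xY ->; exists x; rewrite ?mem_enum.
Qed.

Section SymmetricSubgroups.

Variable T : finType.
Implicit Types (Y : {set T}) (s t : {perm T}).

Definition Sym_on Y : {set {perm T}} := [set s | perm_on Y s].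

Lemma Sym_on_group_set Y : group_set (Sym_on Y).
Proof.
apply/group_setP; split=> [|s t]; rewrite ?inE; first exact: perm_on1.
exact: perm_onM.
Qed.

Canonical Sym_on_group Y := Group (Sym_on_group_set Y).

Lemma Sym_onJ Y s t : (s ^ t \in Sym_on [set t x | x in Y])%g = (s \in Sym_on Y).
Proof.
rewrite !inE; apply/idP/idP => /fintype.subsetP H; apply/fintype.subsetP => x.
  move=> nx; have := H (t x); rewrite (mem_imset _ _ perm_inj); apply.
  by rewrite inE permJ (inj_eq perm_inj).
rewrite inE -{1}[x](permKV t) permJ => nx.
apply/imsetP; exists ((t^-1)%g x); last by rewrite permKV.
apply: H; rewrite inE; apply: contraNneq nx => ->; by rewrite permKV.
Qed.

End SymmetricSubgroups.

(** * Standardization and patterns of labelled points *)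

Section Standardization.

Variable k : nat.
Implicit Types (z : 'I_k -> nat) (s t : 'S_k).

(* The relative order of z; the default value 1 is used when z is not injective. *)
Definition standardization z : 'S_k :=
  odflt 1%g [pick s : 'S_k | [forall i, forall j, (s i < s j)%N == (z i < z j)%N]].

(** A value of a permutation is its rank, so comparisons alone determine the permutation; this makes
    standardizations unique. *)
Lemma card_perm_lt s i : #|[set j | (s j < s i)%N]| = s i.
Proof.
rewrite -sum1_card (reindex_inj (@perm_inj _ s^-1%g)) /=.
rewrite (eq_bigl (fun p : 'I_k => (p < s i)%N)); last by move=> p; rewrite inE permKV.
by rewrite (big_ord_narrow (ltnW (ltn_ord (s i)))) /= sum1_card card_ord.
Qed.

Lemma perm_lt_inj s t : (forall i j, (s i < s j)%N = (t i < t j)%N) -> s = t.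
Proof.
move=> st; apply/permP => i; apply: val_inj.
rewrite /= -card_perm_lt -(card_perm_lt t); apply: eq_card => j.
by rewrite !inE st.
Qed.

Lemma standardizationP z : injective z ->
  forall i j, (standardization z i < standardization z j)%N = (z i < z j)%N.
Proof.
move=> zI; rewrite /standardization; case: pickP => [s sP i j|none] /=.
  by move/forallP: sP => /(_ i)/forallP/(_ j)/eqP.
exfalso.
(* The required order is realized by the rank of [z i], which is below [k] because [i] does not
   count itself. *)
have rk i : (#|[set j | (z j < z i)%N]| < k)%N.
  rewrite -[X in (_ < X)%N]card_ord -cardsT; apply: proper_card.
  apply/properP; split; first by apply/fintype.subsetP => j; rewrite !inE.
  by exists i; rewrite ?inE ?ltnn.
have rk_lt i j : (z i < z j)%N ->
    (#|[set l | (z l < z i)%N]| < #|[set l | (z l < z j)%N]|)%N.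
  move=> ij; apply: proper_card; apply/properP; split.
    by apply/fintype.subsetP => l; rewrite !inE => li; apply: ltn_trans ij.
  by exists i; rewrite !inE ?ltnn.
pose f i := Ordinal (rk i).
have f_lt i j : (f i < f j)%N = (z i < z j)%N.
  case: (ltngtP (z i) (z j)) => [/rk_lt //|/rk_lt|/zI ->] /=; last by rewrite ltnn.
  by move=> ji; apply/negbTE; rewrite -leqNgt ltnW.
have f_inj : injective f.
  move=> i j ij; apply: zI; move: (f_lt i j) (f_lt j i); rewrite ij ltnn.
  by case: ltngtP.
have /negP := none (perm f_inj); apply.
by apply/forallP => i; apply/forallP => j; rewrite !permE f_lt.
Qed.

Lemma standardization_unique s z :
  (forall i j, (s i < s j)%N = (z i < z j)%N) -> standardization z = s.
Proof.
move=> sz; have zI : injective z.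
  move=> i j zij; apply: (@perm_inj _ s); apply/val_inj.
  by move: (sz i j) (sz j i); rewrite zij ltnn; case: ltngtP.
by apply: perm_lt_inj => i j; rewrite standardizationP.
Qed.

Lemma standardization_perm s z : injective z ->
  standardization (z \o s) = (s * standardization z)%g.
Proof.
by move=> zI; apply: standardization_unique => i j; rewrite !permM standardizationP.
Qed.

End Standardization.

Lemma standardization_comp k n (z : 'I_n -> nat) (a : 'I_k -> 'I_n) :
  injective z -> injective a ->
  standardization (fun i => standardization z (a i)) = standardization (z \o a).
Proof.
move=> zI aI; apply: standardization_unique => i j.
rewrite !standardizationP //; exact: inj_comp.
Qed.

Lemma val_perm_inj n k (al : 'S_n) (a : 'I_k -> 'I_n) :
  injective a -> injective (fun i => al (a i) : nat).
Proof. by move=> aI i j /val_inj/perm_inj/aI. Qed.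
Arguments val_perm_inj {n k} al {a} _.

Section Patterns.

Variables (n k : nat).
Implicit Types (al be pi : 'S_n) (a : 'I_k -> 'I_n).

(* Left to right order is al, height is be. *)
Definition pattern al be a : 'S_k :=
  ((standardization (fun i => al (a i)))^-1 *
   standardization (fun i => be (a i)))%g.

(** Relisting the labels multiplies both standardizations by [s] on the left, and [s] cancels: the
    pattern belongs to the set of labels. *)
Lemma pattern_perm al be a (s : 'S_k) : injective a ->
  pattern al be (a \o s) = pattern al be a.
Proof.
move=> aI; rewrite /pattern.
rewrite (standardization_perm s (val_perm_inj al aI)).
rewrite (standardization_perm s (val_perm_inj be aI)).
by rewrite invMg -mulgA mulKg.
Qed.

(** The point labelled [x] has position [al x] and height [be x], so the permutation seen is [al^-1]
    followed by [be]. *)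
Lemma pattern_relabel al be a :
  pattern 1 (al^-1 * be)%g (fun i => al (a i)) = pattern al be a.
Proof.
rewrite /pattern; congr (_^-1 * _)%g; congr standardization; apply: boolp.funext => i.
  by rewrite perm1.
by rewrite permM permK.
Qed.

End Patterns.

(** * Restriction of a uniform order to some of the labels *)

Section UniformStandardization.

Variables (V : nmodType) (n N : nat) (u : 'I_N -> 'I_n).
Hypothesis uI : injective u.

(** All relative orders on the labels [u i] occur equally often. Cross-multiplying by the factorials
    avoids division, so that [V] can be any [nmodType]. *)
Lemma sum_standardization (g : 'S_N -> V) :
  (\sum_(al : 'S_n) g (standardization (fun i => al (u i)))) *+ N`! =
  (\sum_s g s) *+ n`!.
Proof.
have cS m : #|{: 'S_m}| = m`! by rewrite card_Sn.
(* A permutation [t] of all labels with [t (u i) = u (s i)] turns [s] into a change of variable in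
   the sum over [al]. *)
have shift (s : 'S_N) :
    \sum_(al : 'S_n) g (standardization (fun i => al (u i))) =
    \sum_(al : 'S_n) g (s * standardization (fun i => al (u i)))%g.
  have [|||t tE] := @exists_perm_map _ (map u (enum 'I_N)) (map (u \o s) (enum 'I_N)).
  - by rewrite map_inj_uniq ?enum_uniq.
  - by rewrite map_inj_uniq ?enum_uniq // => i j /uI/perm_inj.
  - by rewrite !size_map.
  have {}tE i : t (u i) = u (s i).
    by move: tE; rewrite -map_comp => /eq_in_map/(_ i); apply; rewrite mem_enum.
  rewrite (reindex_inj (mulgI t)) /=; apply: eq_bigr => al _; congr g.
  rewrite -(standardization_perm s (val_perm_inj al uI)).
  by congr standardization; apply: boolp.funext => i; rewrite permM tE.
rewrite -{1}cS -sumr_const (eq_bigr _ (fun s _ => shift s)) exchange_big /=.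
rewrite -cS -[RHS]sumr_const; apply: eq_bigr => al _.
by rewrite [RHS](reindex_inj (mulIg (standardization (fun i => al (u i))))).
Qed.

End UniformStandardization.

(** * Pairs of k-sets with m common labels *)

Section CanonicalPair.

Variables (k m : nat).

(* Two injections of 'I_k into k + (k - m) labels that agree on the first m
   arguments and have otherwise disjoint ranges. *)
Definition pair1 : 'I_k -> 'I_(k + (k - m)) := lshift (k - m).
Definition pair2 (i : 'I_k) : 'I_(k + (k - m)) :=
  if (i < m)%N then lshift (k - m) i
  else Ordinal (etrans (ltn_add2r (k - m) i k) (ltn_ord i)).

Lemma pair2_val i : pair2 i = (if (i < m)%N then i : nat else (i + (k - m))%N) :> nat.
Proof. by rewrite /pair2; case: ifP. Qed.

Lemma pair1_inj : injective pair1. Proof. exact: lshift_inj. Qed.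

Lemma pair2_inj : injective pair2.
Proof.
move=> i j /(congr1 val); rewrite /= !pair2_val => ij; apply: val_inj => /=.
move: ij; case: (ltnP i m) => im; case: (ltnP j m) => jm ij //.
- by move: im; rewrite ij ltnNge (leq_trans jm (leq_addr _ _)).
- by move: jm; rewrite -ij ltnNge (leq_trans im (leq_addr _ _)).
exact: addIn ij.
Qed.

End CanonicalPair.
Lemma exists_perm_comp (T : finType) k (a a' : 'I_k -> T) :
  injective a' -> (forall i, a' i \in codom a) ->
  exists s : 'S_k, forall i, a' i = a (s i).
Proof.
move=> a'I sub; pose f i := iinv (sub i).
have fE i : a (f i) = a' i by rewrite f_iinv.
have fI : injective f by move=> i j ij; apply: a'I; rewrite -!fE ij.
by exists (perm fI) => i; rewrite permE fE.
Qed.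

Definition common_labels n k (a b : 'I_k -> 'I_n) : nat :=
  #|[set a i | i : 'I_k] :&: [set b i | i : 'I_k]|.

(** The injection [u] lists the common labels, then those of [a] alone, then those of [b] alone.
    Positivity of [k] supplies the default element for [nth]. *)
Lemma canonical_pair n k m (a b : 'I_k -> 'I_n) : (0 < k)%N ->
  injective a -> injective b -> common_labels a b = m ->
  exists u : 'I_(k + (k - m)) -> 'I_n, injective u /\
  exists s t : 'S_k, (forall i, u (pair1 m i) = a (s i)) /\
                     (forall i, u (pair2 m i) = b (t i)).
Proof.
move=> k0 aI bI; rewrite /common_labels.
set A := [set a i | i : 'I_k]; set B := [set b i | i : 'I_k] => ABm.
have cA : #|A| = k by rewrite card_imset // card_ord.
have cB : #|B| = k by rewrite card_imset // card_ord.
have mk : (m <= k)%N by rewrite -ABm -[X in (_ <= X)%N]cA subset_leq_card // subsetIl.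
have cAB : #|A :\: B| = (k - m)%N by rewrite cardsD cA ABm.
have cBA : #|B :\: A| = (k - m)%N by rewrite cardsD cB finset.setIC ABm.
pose sq := enum (A :&: B) ++ enum (A :\: B) ++ enum (B :\: A).
have ssq : size sq = (k + (k - m))%N.
  by rewrite !size_cat -!cardE ABm cAB cBA addnA subnKC.
have usq : uniq sq.
  rewrite !cat_uniq !enum_uniq /= andbT; apply/andP; split.
    apply/hasPn => x; rewrite mem_cat !mem_enum !inE.
    by case: (x \in A); case: (x \in B).
  apply/hasPn => x; rewrite !mem_enum !inE.
  by case: (x \in A); case: (x \in B).
pose x0 := a (Ordinal k0).
pose u (i : 'I_(k + (k - m))) := nth x0 sq i.
have uI : injective u.
  move=> i j /eqP; rewrite nth_uniq ?ssq // => /eqP; exact: val_inj.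
exists u; split=> //.
have codA x : (x \in codom a) = (x \in A).
  by apply/codomP/imsetP => -[i]; [move=> ->; exists i | move=> _ ->; exists i].
have codB x : (x \in codom b) = (x \in B).
  by apply/codomP/imsetP => -[i]; [move=> ->; exists i | move=> _ ->; exists i].
have [i|s sE] := @exists_perm_comp _ _ a _ (inj_comp uI (@pair1_inj k m)).
  rewrite codA /u /= /sq catA nth_cat.
  have sz : size (enum (A :&: B) ++ enum (A :\: B)) = k.
    by rewrite size_cat -!cardE ABm cAB subnKC.
  rewrite sz ltn_ord.
  have : nth x0 (enum (A :&: B) ++ enum (A :\: B)) i \in
     enum (A :&: B) ++ enum (A :\: B) by rewrite mem_nth // sz.
  by rewrite mem_cat !mem_enum !inE; case: (_ \in A); rewrite ?andbF.
have [i|t tE] := @exists_perm_comp _ _ b _ (inj_comp uI (@pair2_inj k m)).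
  rewrite codB /u /= pair2_val /sq.
  case: (ltnP i m) => im.
    rewrite nth_cat -cardE ABm im.
    have : nth x0 (enum (A :&: B)) i \in enum (A :&: B) by rewrite mem_nth // -cardE ABm.
    by rewrite mem_enum inE => /andP[].
  rewrite catA nth_cat size_cat -!cardE ABm cAB subnKC //.
  have ik : (k <= i + (k - m))%N by rewrite -{1}(subnKC mk) leq_add2r.
  rewrite ltnNge ik /=.
  have : nth x0 (enum (B :\: A)) (i + (k - m) - k) \in enum (B :\: A).
    rewrite mem_nth // -cardE cBA.
    by rewrite -(ltn_add2r k) subnK // addnC ltn_add2l.
  by rewrite mem_enum inE => /andP[].
by exists s, t.
Qed.

Section PairSum.

Variables (V : nmodType) (n k m : nat) (F : 'S_k -> 'S_k -> V).

(** The unnormalized joint moment, with both orders taken on the [2k - m] relevant labels only, so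
    that it does not involve [n]. *)
Definition pair_sum : V :=
  \sum_(x : 'S_(k + (k - m))) \sum_(y : 'S_(k + (k - m)))
    F (pattern x y (@pair1 k m)) (pattern x y (@pair2 k m)).

(** Both orders restrict uniformly to the labels of the two k-sets: [sum_standardization] is applied
    once to [al] and once to [be]. *)
Lemma sum_pattern_pair (a b : 'I_k -> 'I_n) : (0 < k)%N ->
  injective a -> injective b -> common_labels a b = m ->
  (\sum_(al : 'S_n) \sum_(be : 'S_n) F (pattern al be a) (pattern al be b))
    *+ ((k + (k - m))`! ^ 2) = pair_sum *+ (n`! ^ 2).
Proof.
move=> k0 aI bI ab; have [u [uI [s [t [sE tE]]]]] := canonical_pair k0 aI bI ab.
have mk : (m <= k)%N.
  rewrite -ab -[X in (_ <= X)%N]card_ord -(card_imset _ aI) subset_leq_card //.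
  exact: subsetIl.
set N := (k + (k - m))%N in u uI sE tE *.
have patu (al be : 'S_n) (c : 'I_k -> 'I_N) : injective c ->
    pattern al be (u \o c) = pattern (standardization (fun i => al (u i)))
      (standardization (fun i => be (u i))) c.
  move=> cI; rewrite /pattern; congr (_^-1 * _)%g;
    by rewrite standardization_comp //; apply: val_perm_inj.
pose G x y := F (pattern x y (@pair1 k m)) (pattern x y (@pair2 k m)).
have -> : \sum_(al : 'S_n) \sum_(be : 'S_n) F (pattern al be a) (pattern al be b) =
    \sum_(al : 'S_n) \sum_(be : 'S_n) G (standardization (fun i => al (u i)))
       (standardization (fun i => be (u i))).
  apply: eq_bigr => al _; apply: eq_bigr => be _.
  rewrite /G -!patu; [|exact: pair2_inj|exact: pair1_inj].
  have -> : u \o @pair1 k m = a \o s by apply: boolp.funext.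
  have -> : u \o @pair2 k m = b \o t by apply: boolp.funext.
  by rewrite !pattern_perm.
rewrite !expnS !expn0 !muln1 !mulrnA.
rewrite (sum_standardization uI (fun x => \sum_(be : 'S_n) G x (standardization
  (fun i => be (u i))))).
rewrite mulrnAC; congr (_ *+ _); rewrite -sumrMnl -[RHS]sumrMnl.
by apply: eq_bigr => x _; rewrite (sum_standardization uI (G x)).
Qed.

End PairSum.
(** * Shuffles of words *)

Section Overlap.

Variable X : eqType.
Implicit Types (s t : seq X).

(** The inner product of two multisets: the number of pairs of equal entries. *)
Definition overlap s t : nat := \sum_(x <- s) count_mem x t.

Lemma overlap_catl s1 s2 t : overlap (s1 ++ s2) t = (overlap s1 t + overlap s2 t)%N.
Proof. exact: big_cat. Qed.

Lemma overlap_catr s t1 t2 : overlap s (t1 ++ t2) = (overlap s t1 + overlap s t2)%N.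
Proof. by rewrite /overlap -big_split /=; apply: eq_bigr => x _; rewrite count_cat. Qed.

Lemma sum_count_mem (r s : seq X) (h : X -> nat) : uniq r -> {subset s <= r} ->
  (\sum_(x <- r) count_mem x s * h x = \sum_(x <- s) h x)%N.
Proof.
move=> ur; elim: s => [|y s IH] sr; first by rewrite big_nil big1.
rewrite big_cons -IH => [|x xs]; last by apply: sr; rewrite inE xs orbT.
rewrite (eq_bigr (fun x => (y == x) * h x + count_mem x s * h x)%N); last first.
  by move=> x _; rewrite -mulnDl.
rewrite big_split /=; congr addn.
have yr : y \in r by apply: sr; rewrite mem_head.
rewrite (bigD1_seq y) //= eqxx mul1n big1 ?addn0 // => x.
by rewrite eq_sym => /negbTE ->.
Qed.

End Overlap.

Section OverlapCons.

Variable X : eqType.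
Implicit Types (s t : seq (seq X)).

Lemma count_mem_cons (x : X) w t :
  count_mem (x :: w) (map (cons x) t) = count_mem w t.
Proof. by rewrite count_map; apply: eq_count => v /=; rewrite eqseq_cons eqxx. Qed.

Lemma overlap_cons x s t : overlap (map (cons x) s) (map (cons x) t) = overlap s t.
Proof. by rewrite /overlap big_map; apply: eq_bigr => w _; rewrite count_mem_cons. Qed.

Lemma overlap_cons_neq x y s t : x != y ->
  overlap (map (cons x) s) (map (cons y) t) = 0%N.
Proof.
move=> nxy; rewrite /overlap big_map big1 // => w _; rewrite count_map.
by apply/eqP; rewrite -leqn0 leqNgt -has_count; apply/hasPn => v _ /=;
  rewrite eqseq_cons eq_sym (negbTE nxy).
Qed.

Lemma overlap_nil_cons x t : overlap [:: [::]] (map (cons x) t) = 0%N.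
Proof.
by rewrite /overlap big_seq1 count_map; apply/eqP; rewrite -leqn0 leqNgt -has_count;
  apply/hasPn => v _.
Qed.

Lemma overlap_cons_nil x s : overlap (map (cons x) s) [:: [::]] = 0%N.
Proof. by rewrite /overlap big_map big1. Qed.

End OverlapCons.

(** The multiset of words left after erasing some of the letters [None], with one entry for each set
    of erased positions. *)
Fixpoint deletions (T : Type) (u : seq (option T)) : seq (seq (option T)) :=
  if u is x :: u' then
    (if x is None then deletions u' else [::]) ++ map (cons x) (deletions u')
  else [:: [::]].

Section Shuffles.

Variables (T : finType) (pA pB : pred T).
Hypothesis pAB : forall t, pA t || pB t.

(* Only the labels common to pA and pB keep their identity in a word. *)
Definition letter (t : T) : option T := if pA t && pB t then Some t else None.

Definition shuffles n (u u' : seq T) : {set n.-tuple T} :=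
  [set s : n.-tuple T | (seq.filter pA s == u) && (seq.filter pB s == u')].

(** What remains of the prescribed subword [u] once [t] is read as first letter; [can_pop] says that
    [u] admits this letter. *)
Definition pop (p : pred T) (t : T) (u : seq T) := if p t then behead u else u.
Definition can_pop (p : pred T) (t : T) (u : seq T) := p t ==> (ohead u == Some t).

Lemma filter_cons_eq (p : pred T) t s u :
  (seq.filter p (t :: s) == u) = can_pop p t u && (seq.filter p s == pop p t u).
Proof.
by rewrite /can_pop /pop /=; case: (p t) => //=; case: u => [|x u] //=; rewrite eqseq_cons (eq_sym t).
Qed.

Lemma letter_both t : pA t -> pB t -> letter t = Some t.
Proof. by rewrite /letter => -> ->. Qed.

Lemma letterA t : pB t = false -> letter t = None.
Proof. by rewrite /letter => ->; rewrite andbF. Qed.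

Lemma letterB t : pA t = false -> letter t = None.
Proof. by rewrite /letter => ->. Qed.

Lemma card_shufflesS n u u' : #|shuffles n.+1 u u'| =
  (\sum_(t | can_pop pA t u && can_pop pB t u') #|shuffles n (pop pA t u) (pop pB t u')|)%N.
Proof.
rewrite -sum1_card.
rewrite (reindex (fun p : T * n.-tuple T => [tuple of p.1 :: p.2])) /=; last first.
  exists (fun s : n.+1.-tuple T => (thead s, [tuple of behead s])) => [[t s] _|s _] /=.
    by rewrite theadE; congr (_, _); apply: val_inj.
  by rewrite [s]tuple_eta; apply: val_inj.
rewrite (eq_bigl (fun p : T * n.-tuple T => (can_pop pA p.1 u && can_pop pB p.1 u')
   && (p.2 \in shuffles n (pop pA p.1 u) (pop pB p.1 u')))); last first.
  case=> t s; rewrite !inE /= !filter_cons_eq.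
  by rewrite andbACA.
rewrite -(pair_big_dep (fun t => can_pop pA t u && can_pop pB t u')
  (fun t s => s \in shuffles n (pop pA t u) (pop pB t u')) (fun _ _ => 1%N)) /=.
by apply: eq_bigr => t _; rewrite sum1_card.
Qed.

(* Both sides obey the same recursion on the heads of u and u': prepending None to a
   word acts on multisets of deletions as 1 + D, where D : w |-> None :: w preserves
   [overlap], so <(1+D)f, (1+D)g> = <f, (1+D)g> + <(1+D)f, g>. *)
Lemma card_shuffles n u u' : all pA u -> all pB u' ->
    (size u + count (predC pA) u' = n)%N ->
  #|shuffles n u u'| = overlap (deletions (map letter u)) (deletions (map letter u')).
Proof.
elim: n u u' => [|n IH] u u'.
  case: u => [|//] _ Bu' /=; rewrite add0n => c0.
  case: u' Bu' c0 => [_ _|b u' /=/andP[Bb _]] /=.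
    rewrite /overlap big_seq1 /=; apply/eqP/cards1P; exists [tuple].
    by apply/setP => s; rewrite !inE [s]tuple0 /= eqxx.
  case Ab: (pA b) => //= _; rewrite (letter_both Ab Bb) /= overlap_nil_cons.
  apply/eqP; rewrite cards_eq0; apply/eqP/setP => s; rewrite !inE [s]tuple0 /=.
  by [].
rewrite card_shufflesS.
case: u => [|a u]; case: u' => [|b u'] //=.
- move=> _ /andP[Bb Bu']; rewrite add0n /can_pop /pop.
  case Ab: (pA b) => /= cn.
    rewrite (letter_both Ab Bb) overlap_nil_cons big_pred0 // => t.
    case At: (pA t) => //=; have := pAB t; rewrite At /= => ->.
    by apply/eqP => -[bt]; rewrite -bt Ab in At.
  rewrite (letterB Ab) overlap_catr overlap_nil_cons addn0.
  rewrite -(IH [::] u') //; last by case: cn.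
  rewrite (big_pred1 b) ?Ab ?Bb // => t /=.
  case At: (pA t) => /=; first by apply/esym/eqP => tb; rewrite tb Ab in At.
  by have := pAB t; rewrite At /= => ->; rewrite eq_sym.
- move=> /andP[Aa Au] _; rewrite addn0 /can_pop /pop.
  case Ba: (pB a) => /= cn.
    rewrite (letter_both Aa Ba) overlap_cons_nil big_pred0 // => t.
    case Bt: (pB t) => /=; first by rewrite andbF.
    have := pAB t; rewrite Bt orbF => -> /=; rewrite andbT.
    by apply/eqP => -[bt]; rewrite -bt Ba in Bt.
  rewrite (letterA Ba) overlap_catl overlap_cons_nil addn0.
  rewrite -(IH u [::]) //; last by case: cn => <-; rewrite addn0.
  rewrite (big_pred1 a) ?Aa ?Ba // => t /=.
  case Bt: (pB t) => /=; first by rewrite andbF; apply/esym/eqP => tb; rewrite tb Ba in Bt.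
  by have := pAB t; rewrite Bt orbF => -> /=; rewrite andbT eq_sym.
move=> /andP[Aa Au] /andP[Bb Bu']; rewrite /can_pop /pop /=.
case Ba: (pB a); case Ab: (pA b) => /= cn.
(* Both heads are common labels: a first letter pops both words, so the heads have to agree. *)
- rewrite (letter_both Aa Ba) (letter_both Ab Bb) /=.
  case: (eqVneq a b) => [eab|nab].
    rewrite -eab overlap_cons -IH //; last by move: cn; rewrite add0n addSn => -[].
    rewrite (big_pred1 a) ?Aa ?Ba // => t /=.
    rewrite !(inj_eq Some_inj) (eq_sym a); have := pAB t.
    case: eqP => [->|_]; first by rewrite Aa Ba.
    by case: (pA t); case: (pB t).
  rewrite overlap_cons_neq; last by rewrite (inj_eq Some_inj).
  rewrite big_pred0 // => t; rewrite !(inj_eq Some_inj).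
  case At: (pA t) => /=; case Bt: (pB t) => /=.
  + by apply/andP => -[/eqP <- /eqP ba]; rewrite ba eqxx in nab.
  + by apply/andP => -[/eqP at_]; rewrite -at_ Ba in Bt.
  + by apply/eqP => bt; rewrite -bt Ab in At.
  + by have := pAB t; rewrite At Bt.
(* Only [a] is common: it has to wait until it also heads the second word, so [b] comes first. The
   next case is symmetric. *)
- rewrite (letter_both Aa Ba) (letterB Ab) /= overlap_catr overlap_cons_neq // addn0.
  have -> : map (cons (Some a)) (deletions (map letter u)) =
      deletions (map letter (a :: u)) by rewrite /= (letter_both Aa Ba).
  rewrite -IH //=; last 2 first.
  + by rewrite Aa.
  + by move: cn; rewrite addnS => -[].
  rewrite (big_pred1 b) ?Ab ?Bb // => t /=; rewrite !(inj_eq Some_inj).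
  have := pAB t; case At: (pA t) => /=.
    move=> _; have -> : (t == b) = false by apply/eqP => tb; rewrite tb Ab in At.
    case: (a =P t) => //= at_; rewrite -at_ Ba /=.
    by apply/eqP => ba; rewrite ba Aa in Ab.
  by move=> -> /=; rewrite eq_sym.
- rewrite (letterA Ba) (letter_both Ab Bb) /= overlap_catl overlap_cons_neq // addn0.
  have -> : map (cons (Some b)) (deletions (map letter u')) =
      deletions (map letter (b :: u')) by rewrite /= (letter_both Ab Bb).
  rewrite -IH //=; last 2 first.
  + by rewrite Bb.
  + by move: cn; rewrite Ab addSn => -[].
  rewrite (big_pred1 a) ?Aa ?Ba // => t /=; rewrite !(inj_eq Some_inj).
  have := pAB t; case Bt: (pB t) => /=.
    move=> _; have -> : (t == a) = false by apply/eqP => ta; rewrite ta Ba in Bt.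
    case: (b =P t) => //= bt; last by rewrite andbF.
    rewrite andbT -bt Ab /=.
    by apply/eqP => ab; rewrite ab Bb in Ba.
  by rewrite orbF => -> /=; rewrite andbT eq_sym.
(* Both heads are private: either may come first, which gives two terms. *)
have nab : b != a by apply/eqP => ba; rewrite -ba Bb in Ba.
rewrite (letterA Ba) (letterB Ab) /= overlap_catl !overlap_catr overlap_cons.
rewrite (bigD1 a) /=; last by rewrite Aa Ba eqxx.
rewrite (big_pred1 b) => [|t] /=; last first.
  rewrite !(inj_eq Some_inj); have := pAB t.
  case: (eqVneq t b) => [->|ntb]; first by rewrite Ab Bb ?eqxx nab.
  case: (eqVneq t a) => [->|nta] /=; first by rewrite andbF.
  by rewrite ?(eq_sym a) ?(eq_sym b) ?(negbTE ntb) ?(negbTE nta) !implybF; case: (pA t); case: (pB t).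
rewrite Aa Ba Ab Bb.
rewrite !IH //=; last 4 first.
+ by rewrite Aa.
+ by move: cn; rewrite addnS => -[].
+ by rewrite Bb.
+ by move: cn; rewrite Ab addSn => -[].
rewrite (letterA Ba) (letterB Ab) /= overlap_catl overlap_catr.
by congr addn; apply: addnC.
Qed.

End Shuffles.
Lemma card_ord_lt k m : (m <= k)%N -> #|[set i : 'I_k | (i < m)%N]| = m.
Proof.
move=> mk; rewrite -sum1_card (eq_bigl (fun i : 'I_k => (i < m)%N)) => [|i].
  by rewrite (big_ord_narrow mk) /= sum1_card card_ord.
by rewrite inE.
Qed.

(** The indices at which [pair1] and [pair2] have private labels. *)
Definition top_set k m : {set 'I_k} := [set i : 'I_k | (m <= i)%N].

Lemma card_top_set k m : (m <= k)%N -> #|top_set k m| = (k - m)%N.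
Proof.
move=> mk; have := cardsC [set i : 'I_k | (i < m)%N].
rewrite card_ord_lt // card_ord => kE; rewrite -[X in (X - _)%N]kE addKn.
by apply: eq_card => i; rewrite !inE leqNgt.
Qed.

(** * The second moment as a quadratic form *)

Section OrderTuple.

Variable N : nat.
Implicit Types t : 'S_N.

(** The labels read from left to right when [t] gives their positions. *)
Definition order_tuple t : N.-tuple 'I_N := [tuple (t^-1)%g p | p < N].

Lemma order_tupleE t : order_tuple t = [seq (t^-1)%g p | p <- enum 'I_N] :> seq _.
Proof. by []. Qed.

Lemma order_tuple_inj : injective order_tuple.
Proof.
move=> s t /(congr1 (@tval _ _)); rewrite !order_tupleE => /eq_in_map st.
by apply: invg_inj; apply/permP => p; apply: st; rewrite mem_enum.
Qed.

Lemma order_tupleP (s : N.-tuple 'I_N) : uniq s -> exists t, order_tuple t = s.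
Proof.
move=> us; have sI : injective (tnth s) by apply/tuple_uniqP.
exists ((perm sI)^-1)%g; apply: eq_from_tnth => p.
by rewrite tnth_map tnth_ord_tuple invgK permE.
Qed.

Lemma sorted_ltn_enum_ord k : sorted (fun i j : 'I_k => (i < j)%N) (enum 'I_k).
Proof. by have := iota_ltn_sorted 0 k; rewrite -val_enum_ord sorted_map. Qed.

(** Both lists are sorted by the position [t] and have the same members. *)
Lemma filter_order_tuple k (p : pred 'I_N) (a : 'I_k -> 'I_N) t :
  injective a -> (forall x, p x = (x \in codom a)) ->
  seq.filter p (order_tuple t) =
  [seq a ((standardization (fun i => t (a i)))^-1%g q) | q <- enum 'I_k].
Proof.
move=> aI pa; set z := standardization _.
pose lt_t (x y : 'I_N) := (t x < t y)%N.
have lt_tr : transitive lt_t by move=> y x w; apply: ltn_trans.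
apply: (irr_sorted_eq lt_tr) => [x||| x].
- exact: ltnn.
- apply: sorted_filter => //; rewrite order_tupleE sorted_map.
  rewrite (eq_sorted (e' := fun i j : 'I_N => (i < j)%N)); first exact: sorted_ltn_enum_ord.
  by move=> i j; rewrite /lt_t /= !permKV.
- rewrite sorted_map.
  rewrite (eq_sorted (e' := fun i j : 'I_k => (i < j)%N)); first exact: sorted_ltn_enum_ord.
  move=> i j; rewrite /lt_t /= -(standardizationP (val_perm_inj t aI)).
  by rewrite -/z !permKV.
rewrite mem_filter pa order_tupleE.
have -> : x \in [seq (t^-1)%g p | p <- enum 'I_N].
  by apply/mapP; exists (t x); rewrite ?mem_enum ?permK.
rewrite andbT; apply/codomP/mapP => [[i ->]|[q _ ->]]; last by eexists.
by exists (z i); rewrite ?mem_enum ?permK.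
Qed.

End OrderTuple.

Section Words.

Variables (k m : nat).
Hypothesis mk : (m <= k)%N.
Local Notation N := (k + (k - m))%N.
Implicit Types (x y s : 'S_k) (t : 'S_N).

Definition in_pair1 (l : 'I_N) := (l < k)%N.
Definition in_pair2 (l : 'I_N) := (l < m)%N || (k <= l)%N.

Lemma leq_addB i : (m <= i)%N -> (k <= i + (k - m))%N.
Proof. by move=> mi; rewrite -{1}(subnKC mk) leq_add2r. Qed.

Lemma in_pair12 l : in_pair1 l || in_pair2 l.
Proof. by rewrite /in_pair1 /in_pair2; case: (ltnP l k); rewrite ?orbT. Qed.

Lemma in_pair1E l : in_pair1 l = (l \in codom (@pair1 k m)).
Proof.
apply/idP/codomP => [lk|[i ->]]; last exact: ltn_ord i.
by exists (Ordinal lk); apply: val_inj.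
Qed.

Lemma in_pair2_pair2 i : in_pair2 (pair2 m i).
Proof.
rewrite /in_pair2 pair2_val; case: (ltnP i m) => [->//|mi].
by rewrite leq_addB ?orbT.
Qed.

Lemma in_pair2E l : in_pair2 l = (l \in codom (@pair2 k m)).
Proof.
apply/idP/codomP => [|[i ->]]; last exact: in_pair2_pair2.
case/orP => [lm|kl].
  exists (Ordinal (leq_trans lm mk)); apply: val_inj.
  by rewrite /= pair2_val /= lm.
have km_l : (k - m <= l)%N by apply: leq_trans (leq_subr _ _) kl.
have lk : (l - (k - m) < k)%N by rewrite -(ltn_add2r (k - m)) subnK.
have ml : (m <= l - (k - m))%N by rewrite leq_subRL // subnK.
exists (Ordinal lk); apply: val_inj; rewrite /= pair2_val /=.
by rewrite ltnNge ml /= subnK.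
Qed.

(** The labels of the first k-set read in the order [x], with private labels anonymized. By
    [letter_pair2] the second k-set yields the same words. *)
Definition word x : seq (option 'I_N) :=
  [seq letter in_pair1 in_pair2 (pair1 m ((x^-1)%g p)) | p <- enum 'I_k].

Lemma letter_pair1 i : letter in_pair1 in_pair2 (pair1 m i) =
  if (i < m)%N then Some (pair1 m i) else None.
Proof. by rewrite /letter /in_pair1 /in_pair2 /= ltn_ord [(k <= i)%N]leqNgt ltn_ord orbF. Qed.

Lemma letter_pair2 i :
  letter in_pair1 in_pair2 (pair2 m i) = letter in_pair1 in_pair2 (pair1 m i).
Proof.
rewrite letter_pair1 /letter in_pair2_pair2 andbT /in_pair1 pair2_val.
case: (ltnP i m) => im; last first.
  by rewrite ltnNge leq_addB.
by rewrite ltn_ord; congr Some; apply: val_inj; rewrite /= pair2_val im.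
Qed.

(** The cardinality is the entry K(x, y) of the introductory comment. *)
Definition joint_set x y : {set 'S_N} :=
  [set t : 'S_N | (standardization (fun i => t (pair1 m i)) == x) &&
           (standardization (fun i => t (pair2 m i)) == y)].

Definition label_seq (a : 'I_k -> 'I_N) x : seq 'I_N :=
  [seq a ((x^-1)%g q) | q <- enum 'I_k].

Lemma label_seq_inj a : injective a -> injective (label_seq a).
Proof.
move=> aI x y /eq_in_map xy; apply: invg_inj; apply/permP => p.
by apply: aI; apply: xy; rewrite mem_enum.
Qed.

Lemma mem_joint_set t x y : (t \in joint_set x y) =
  (order_tuple t \in shuffles in_pair1 in_pair2 N
     (label_seq (@pair1 k m) x) (label_seq (@pair2 k m) y)).
Proof.
rewrite !inE (filter_order_tuple t (@pair1_inj k m) in_pair1E).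
rewrite (filter_order_tuple t (@pair2_inj k m) in_pair2E).
by rewrite !(inj_eq (label_seq_inj _)) //; [apply: pair2_inj | apply: pair1_inj].
Qed.

Lemma mem_label_seq a x l : (l \in label_seq a x) = (l \in codom a).
Proof.
apply/mapP/codomP => [[q _ ->]|[i ->]]; first by eexists.
by exists (x i); rewrite ?mem_enum ?permK.
Qed.

(** Each of the [N] labels lies in one of the k-sets and hence occurs; a word of length [N] has no
    room for repetitions. *)
Lemma shuffles_uniq x y (s : N.-tuple 'I_N) :
  s \in shuffles in_pair1 in_pair2 N
     (label_seq (@pair1 k m) x) (label_seq (@pair2 k m) y) -> uniq s.
Proof.
rewrite inE => /andP[/eqP s1 /eqP s2].
apply: (leq_size_uniq (enum_uniq 'I_N)); last by rewrite -cardE card_ord size_tuple.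
move=> l _; case/orP: (in_pair12 l) => ll.
  have : l \in label_seq (@pair1 k m) x by rewrite mem_label_seq -in_pair1E.
  by rewrite -s1 mem_filter => /andP[].
have : l \in label_seq (@pair2 k m) y by rewrite mem_label_seq -in_pair2E.
by rewrite -s2 mem_filter => /andP[].
Qed.

Lemma card_joint_set x y :
  #|joint_set x y| = overlap (deletions (word x)) (deletions (word y)).
Proof.
rewrite -(card_imset _ (@order_tuple_inj N)).
transitivity #|shuffles in_pair1 in_pair2 N
     (label_seq (@pair1 k m) x) (label_seq (@pair2 k m) y)|.
  apply: eq_card => s; apply/imsetP/idP => [[t]|sh].
    by rewrite mem_joint_set => ts ->.
  have [t tE] := order_tupleP (shuffles_uniq sh).
  by exists t; rewrite ?mem_joint_set tE.
rewrite (card_shuffles in_pair12).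
- congr (overlap (deletions _) (deletions _));
    rewrite /word /label_seq -map_comp; apply: eq_map => q //=.
  exact: letter_pair2.
- by apply/allP => l; rewrite mem_label_seq -in_pair1E.
- by apply/allP => l; rewrite mem_label_seq -in_pair2E.
(* The length condition remains: exactly [k - m] labels of the second k-set are outside the
   first. *)
rewrite size_map -cardE card_ord; congr addn.
rewrite count_map -sum1_count big_enum_cond /= (reindex_inj (@perm_inj _ y)) /=.
rewrite -(card_top_set mk) -sum1_card; apply: eq_bigl => i.
rewrite permK /in_pair1 pair2_val inE -leqNgt.
case: (ltnP i m) => im; first by rewrite leqNgt ltn_ord.
by rewrite leq_addB.
Qed.

End Words.

(** * Gram decomposition and positivity *)

Section DeletionCount.

Variable T : eqType.
Implicit Types (u w : seq (option T)).

Lemma size_deletions u w : w \in deletions u -> (size w <= size u)%N.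
Proof.
elim: u w => [|a u IH] w /=; first by rewrite inE => /eqP->.
rewrite mem_cat => /orP[|/mapP[w' /IH ww' ->]] //.
by case: a => // /IH /leqW.
Qed.

(** Only the empty set of erasures preserves the length, and it yields [u] once. *)
Lemma count_mem_deletions u w : size w = size u -> count_mem w (deletions u) = (w == u).
Proof.
elim: u w => [|a u IH] [|b w] //= [sw].
rewrite count_cat (_ : count _ (if a is None then _ else _) = 0%N) ?add0n.
  rewrite count_map eqseq_cons; case: (eqVneq b a) => [->|nba] /=.
    by rewrite -IH //; apply: eq_count => v /=; rewrite eqseq_cons eqxx.
  rewrite (eq_count (a2 := pred0)) ?count_pred0 // => v /=.
  by rewrite eqseq_cons eq_sym (negbTE nba).
apply/count_memPn; case: a => //; apply/negP => /size_deletions /=.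
by rewrite sw ltnn.
Qed.

End DeletionCount.

Section QuadraticForm.

Variables (R : realType) (k m : nat) (v : 'S_k -> R).
Hypothesis mk : (m <= k)%N.
Local Notation N := (k + (k - m))%N.
Local Notation S := (Sym_on_group (top_set k m)).
Local Notation wordm := (@word k m).

Definition all_deletions : seq (seq (option 'I_N)) :=
  undup (flatten [seq deletions (wordm x) | x : 'S_k]).

(** The vector L_th of the Gram decomposition, as a function of [x]. *)
Definition del_count (th : seq (option 'I_N)) (x : 'S_k) : R :=
  (count_mem th (deletions (wordm x)))%:R.

Lemma overlap_del_count x y :
  (overlap (deletions (wordm x)) (deletions (wordm y)))%:R =
  \sum_(th <- all_deletions) del_count th x * del_count th y.
Proof.
rewrite /overlap -(sum_count_mem (r := all_deletions)) ?undup_uniq //.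
  by rewrite natr_sum; apply: eq_bigr => th _; rewrite natrM.
move=> w wx; rewrite mem_undup; apply/flattenP; exists (deletions (wordm x)) => //.
by apply/mapP; exists x; rewrite ?mem_enum.
Qed.

Lemma sum_joint (h : 'S_k -> 'S_k -> R) :
  \sum_(t : 'S_N) h (standardization (fun i => t (pair1 m i)))
                    (standardization (fun i => t (pair2 m i))) =
  \sum_x \sum_y (overlap (deletions (wordm x)) (deletions (wordm y)))%:R * h x y.
Proof.
rewrite (partition_big (fun t : 'S_N => standardization (fun i => t (pair1 m i))) xpredT) //=.
apply: eq_bigr => x _.
rewrite (partition_big (fun t : 'S_N => standardization (fun i => t (pair2 m i))) xpredT) //=.
apply: eq_bigr => y _.
rewrite (eq_bigr (fun=> h x y)); last by move=> t /andP[/eqP-> /eqP->].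
rewrite sumr_const -card_joint_set // mulr_natl; congr (_ *+ _).
by apply: eq_card => t; rewrite !inE.
Qed.

Lemma sum_joint_mul (f g : 'S_k -> R) :
  \sum_(t : 'S_N) f (standardization (fun i => t (pair1 m i))) *
                  g (standardization (fun i => t (pair2 m i))) =
  \sum_(th <- all_deletions)
    (\sum_x del_count th x * f x) * (\sum_x del_count th x * g x).
Proof.
rewrite (sum_joint (fun x y => f x * g y)).
under [RHS]eq_bigr do rewrite mulr_suml.
rewrite [RHS]exchange_big; apply: eq_bigr => x _ /=.
under [RHS]eq_bigr do rewrite mulr_sumr.
rewrite [RHS]exchange_big; apply: eq_bigr => y _ /=.
rewrite overlap_del_count mulr_suml; apply: eq_bigr => th _.
by rewrite mulrACA.
Qed.

(** The pairing of (x, y) |-> v(x^-1 y) with the tensor product of L_th and L_et. *)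
Definition form_coef (th et : seq (option 'I_N)) : R :=
  \sum_x del_count th x * \sum_y del_count et y * v (x^-1 * y)%g.

(** The Gram decomposition is used for the heights and then for the positions. Both k-sets carry the
    same function [v], so the products are squares. *)
Lemma pair_sum_squares : pair_sum m (fun x y => v x * v y) =
  \sum_(et <- all_deletions) \sum_(th <- all_deletions) form_coef th et ^+ 2.
Proof.
rewrite /pair_sum /pattern.
under eq_bigr => t _.
  rewrite (sum_joint_mul (fun y => v ((standardization (fun i => t (pair1 m i)))^-1 * y)%g)
   (fun y => v ((standardization (fun i => t (pair2 m i)))^-1 * y)%g)).
  over.
rewrite exchange_big; apply: eq_bigr => et _ /=.
by rewrite (sum_joint_mul (fun x => \sum_y del_count et y * v (x^-1 * y)%g)
  (fun x => \sum_y del_count et y * v (x^-1 * y)%g)).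
Qed.

Lemma pair_sum_ge0 : 0 <= pair_sum m (fun x y => v x * v y).
Proof.
by rewrite pair_sum_squares; do 2!(apply: sumr_ge0 => ? _); apply: sqr_ge0.
Qed.

Lemma Sym_on_topP (s : 'S_k) :
  reflect (forall i : 'I_k, (i < m)%N -> s i = i) (s \in S).
Proof.
rewrite inE; apply: (iffP fintype.subsetP) => [sm i im|sm i].
  by apply/eqP; apply: contraTT im => /sm; rewrite inE -leqNgt.
by rewrite !inE; apply: contraR; rewrite -ltnNge => /sm->.
Qed.

(** The words agree iff [x] and [y] send every shared index to the same place, that is, iff
    [x * y^-1] fixes all [i < m]. *)
Lemma word_eq (x y : 'S_k) : (wordm x == wordm y) = ((x * y^-1)%g \in S).
Proof.
apply/eqP/Sym_on_topP => [xy i im|xy].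
  move/eq_in_map: xy => /(_ (x i)); rewrite mem_enum => /(_ isT).
  rewrite permK !letter_pair1 im permM; case: ifP => // _ [] e.
  by apply: val_inj; rewrite /= -e.
apply/eq_in_map => p _; rewrite !letter_pair1.
set i := (x^-1%g p); set j := (y^-1%g p).
have ji : j = (x * y^-1)%g i by rewrite permM permKV.
case: (ltnP i m) => im; first by rewrite ji xy // im.
suff -> : (j < m)%N = false by [].
apply/negP => jm; have : (x * y^-1)%g j = j by apply: xy.
by rewrite {2}ji => /perm_inj ij; move: jm; rewrite ij ltnNge im.
Qed.

(** [del_count et] is invariant under left multiplication by [S], so the sum over [y] can be
    averaged over [S]; coset sums of [v] appear. *)
Lemma pair_sum_eq0 :
  (forall x y, \sum_(s in S) v (x * s * y)%g = 0) ->
  pair_sum m (fun x y => v x * v y) = 0.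
Proof.
move=> v0; rewrite pair_sum_squares big1 // => et _; rewrite big1 // => th _.
rewrite /form_coef big1 ?expr0n // => x _.
suff -> : \sum_y del_count et y * v (x^-1 * y)%g = 0 by rewrite mulr0.
have cS : (#|S|%:R : R) != 0 by rewrite pnatr_eq0 -lt0n cardG_gt0.
apply: (mulfI cS); rewrite mulr0 -sum1_card natr_sum mulr_suml.
transitivity (\sum_(s in S) \sum_y del_count et y * v (x^-1 * s * y)%g).
  apply: eq_bigr => s sS; rewrite mul1r (reindex_inj (mulgI s)) /=.
  apply: eq_bigr => y _; rewrite mulgA; congr (_ * _).
  rewrite /del_count; suff -> : wordm (s * y)%g = wordm y by [].
  by apply/eqP; rewrite word_eq mulgK.
by rewrite exchange_big big1 // => y _; rewrite -mulr_sumr v0 mulr0.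
Qed.

(* A deletion of a word as long as the word is the word itself, and the words of x and
   x0 agree iff x and x0 are in the same right coset of S. *)
Lemma form_coef_word (x0 y0 : 'S_k) : form_coef (wordm x0) (wordm y0) =
  #|S|%:R * \sum_(s in S) v (x0^-1 * s * y0)%g.
Proof.
have dcE (x y : 'S_k) : del_count (wordm x) y = ((y * x^-1)%g \in S)%:R.
  by rewrite /del_count count_mem_deletions ?size_map // eq_sym word_eq.
rewrite /form_coef (reindex_inj (mulIg x0)) /=.
under eq_bigr => x _.
  rewrite dcE mulgK.
  rewrite (reindex_inj (mulIg y0)) /=.
  under eq_bigr => y _ do rewrite dcE mulgK.
  over.
rewrite -sum1_card natr_sum mulr_suml big_mkcond [RHS]big_mkcond /=.
apply: eq_bigr => s _; case sS: (s \in S); last by rewrite mul0r.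
rewrite !mul1r [RHS]big_mkcond /= (reindex_inj (mulgI s)) /=.
apply: eq_bigr => t _; rewrite groupMl // invMg -!mulgA mulKg.
by case: (t \in S); rewrite ?mul1r ?mul0r.
Qed.

(** One of the squares belongs to the undeleted words of [x0^-1] and [y0]; its root is [#|S|] times
    the given coset sum. *)
Lemma pair_sum_gt0 x0 y0 : \sum_(s in S) v (x0 * s * y0)%g != 0 ->
  0 < pair_sum m (fun x y => v x * v y).
Proof.
move=> v0; rewrite lt_neqAle pair_sum_ge0 andbT eq_sym.
apply: contraNneq v0 => /eqP; rewrite pair_sum_squares.
have inall x : wordm x \in all_deletions.
  rewrite mem_undup; apply/flattenP; exists (deletions (wordm x)).
    by apply/mapP; exists x; rewrite ?mem_enum.
  by rewrite -has_pred1 has_count count_mem_deletions // eqxx.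
rewrite psumr_eq0 => [/allP/(_ _ (inall y0)) /= /eqP/eqP|et _]; last first.
  by apply: sumr_ge0 => th _; apply: sqr_ge0.
rewrite psumr_eq0 => [/allP/(_ _ (inall x0^-1%g)) /=|th _]; last exact: sqr_ge0.
rewrite sqrf_eq0 form_coef_word invgK mulf_eq0 pnatr_eq0.
by rewrite -leqn0 leqNgt cardG_gt0.
Qed.

End QuadraticForm.
(** * Exact formula for the second moment *)

Section Counting.

Variables (n k : nat).

(** The map sending [B] to its parts inside and outside [A] is a bijection onto pairs of subsets of
    [A] and of its complement. *)
Lemma card_overlap_sets (A : {set 'I_n}) m : #|A| = k -> (m <= k)%N ->
  #|[set B : {set 'I_n} | (#|B| == k) && (#|A :&: B| == m)]| =
  ('C(k, m) * 'C(n - k, k - m))%N.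
Proof.
move=> cA mk.
have cAC : #|~: A| = (n - k)%N.
  by have := cardsC A; rewrite card_ord cA => nE; rewrite -[X in (X - _)%N]nE addKn.
pose D (E : {set 'I_n}) j := [set B : {set 'I_n} | (B \subset E) && (#|B| == j)].
have -> : ('C(k, m) * 'C(n - k, k - m))%N = #|finset.setX (D A m) (D (~: A) (k - m)%N)|.
  by rewrite cardsX /D !cards_draws cA cAC.
pose f (B : {set 'I_n}) := (B :&: A, B :\: A).
have fI : injective f by move=> B B' [e1 e2]; rewrite -(finset.setID B A) e1 e2 finset.setID.
rewrite -(card_imset _ fI); apply: eq_card => -[B1 B2].
apply/imsetP/idP => [[B]|].
  rewrite inE => /andP[/eqP cB /eqP cAB] [-> ->].
  rewrite !inE finset.subsetIr /= finset.setIC cAB eqxx /= cardsD finset.setIC cAB cB eqxx.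
  by rewrite finset.setDE finset.subsetIr.
rewrite !inE /= => /andP[/andP[B1A /eqP cB1] /andP[B2A /eqP cB2]].
have d1 : A :&: (B1 :|: B2) = B1.
  rewrite finset.setIUr (finset.setIidPr B1A).
  suff -> : A :&: B2 = finset.set0 by rewrite finset.setU0.
  by apply/eqP; rewrite finset.setI_eq0 disjoint_sym finset.disjoints_subset.
exists (B1 :|: B2); last first.
  rewrite /f finset.setIC d1; congr (_, _).
  rewrite finset.setDUl (eqP (_ : B1 :\: A == finset.set0)) ?finset.setD_eq0 // finset.set0U.
  by apply/esym/finset.setDidPl; rewrite finset.disjoints_subset.
rewrite inE d1 cB1 eqxx andbT.
rewrite cardsU cB1 cB2 (_ : B1 :&: B2 = finset.set0) ?cards0 ?subn0 ?subnKC //.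
apply/eqP; rewrite finset.setI_eq0 finset.disjoints_subset.
apply: fintype.subset_trans B1A _; by rewrite -(finset.setCK A) finset.setCS.
Qed.

Definition image_of (a : {ffun 'I_k -> 'I_n}) : {set 'I_n} := [set a i | i : 'I_k].

Lemma card_injections_onto (B : {set 'I_n}) : #|B| = k ->
  #|[set b : {ffun 'I_k -> 'I_n} | injectiveb b && (image_of b == B)]| = k`!.
Proof.
move=> cB; have := card_inj_ffuns_on 'I_k (mem B).
rewrite cB card_ord ffactnn => <-; apply: eq_card => b; rewrite !inE.
rewrite [RHS]andbC; case bI: (injectiveb b) => //=.
apply/eqP/ffun_onP => [<- i|bB]; first exact: imset_f.
apply/eqP; rewrite eqEcard cB card_imset ?card_ord ?leqnn ?andbT; last exact/injectiveP.
by apply/fintype.subsetP => _ /imsetP[i _ ->].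
Qed.

Lemma card_injections_overlap (a : {ffun 'I_k -> 'I_n}) m : injective a -> (m <= k)%N ->
  #|[set b : {ffun 'I_k -> 'I_n} | injectiveb b && (common_labels a b == m)]| =
  ('C(k, m) * 'C(n - k, k - m) * k`!)%N.
Proof.
move=> aI mk; rewrite -(@card_overlap_sets (image_of a)) ?card_imset ?card_ord //.
rewrite -sum1_card (partition_big image_of (fun B =>
  B \in [set B : {set 'I_n} | (#|B| == k) && (#|image_of a :&: B| == m)])) /=; last first.
  move=> b; rewrite !inE => /andP[/injectiveP bI cb].
  by rewrite card_imset ?card_ord ?eqxx.
rewrite -sum_nat_const; apply: eq_bigr => B; rewrite inE => /andP[/eqP cB /eqP cAB].
rewrite -(card_injections_onto cB) -sum1_card; apply: eq_bigl => b.
rewrite !inE -andbA; congr andb; case: (image_of b =P B) => [bB|_]; last by rewrite andbF.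
by rewrite andbT /common_labels -/(image_of b) -/(image_of a) bB cAB eqxx.
Qed.

Lemma card_injections :
  #|[set a : {ffun 'I_k -> 'I_n} | injectiveb a]| = ('C(n, k) * k`!)%N.
Proof.
by rewrite bin_ffact card_inj_ffuns !card_ord.
Qed.

End Counting.

Lemma common_labels_le n k (a b : 'I_k -> 'I_n) : (common_labels a b <= k)%N.
Proof.
rewrite /common_labels; apply: leq_trans (subset_leq_card (finset.subsetIl _ _)) _.
by apply: leq_trans (leq_imset_card _ _) _; rewrite card_ord.
Qed.

(** * From k-subsets to increasing maps and injections *)

Section Increasing.

Variables (n k : nat).
Implicit Types (a b : {ffun 'I_k -> 'I_n}) (pi : 'S_n).

Lemma increasingP a : reflect (forall i j, (a i < a j)%N = (i < j)%N) (increasing a).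
Proof.
apply: (iffP forallP) => [inc i j|aE i]; last first.
  by apply/forallP => j; rewrite aE implybb.
have {}inc (i' j' : 'I_k) : (i' < j')%N -> (a i' < a j')%N.
  by move/forallP: (inc i') => /(_ j')/implyP.
case: (ltngtP i j) => [/inc //|/inc|/val_inj ->]; last by rewrite ltnn.
by move=> ji; apply/negbTE; rewrite -leqNgt ltnW.
Qed.

Lemma increasing_inj a : increasing a -> injective a.
Proof.
move/increasingP => aE i j aij; apply: val_inj.
by move: (aE i j) (aE j i); rewrite aij ltnn /=; case: ltngtP.
Qed.

Lemma increasing_standardization a : injective a ->
  increasing a = (standardization (fun i => a i) == 1%g).
Proof.
move=> aI; have zI : injective (fun i => a i : nat) by move=> i j /val_inj/aI.
apply/increasingP/eqP => [aE|a1 i j].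
  by apply: standardization_unique => i j; rewrite !perm1 aE.
by rewrite -(standardizationP zI) a1 !perm1.
Qed.

Lemma increasing_image_inj a b : increasing a -> increasing b ->
  image_of a = image_of b -> a = b.
Proof.
move=> ia ib ab.
have lt_tr : transitive (fun i j : 'I_n => (i < j)%N) by move=> y x w; apply: ltn_trans.
have srt (c : {ffun 'I_k -> 'I_n}) : increasing c -> sorted (fun i j : 'I_n => (i < j)%N) (map c (enum 'I_k)).
  move/increasingP => cE; rewrite sorted_map.
  rewrite (eq_sorted (e' := fun i j : 'I_k => (i < j)%N)); first exact: sorted_ltn_enum_ord.
  by move=> i j /=; rewrite cE.
have mem_im (c : {ffun 'I_k -> 'I_n}) x : (x \in map c (enum 'I_k)) = (x \in image_of c).
  by apply/mapP/imsetP => -[i _ ->]; exists i; rewrite ?mem_enum.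
have : map a (enum 'I_k) = map b (enum 'I_k).
  apply: (irr_sorted_eq lt_tr); [by move=> x; rewrite /= ltnn | exact: srt | exact: srt |].
  by move=> x; rewrite !mem_im ab.
by move/eq_in_map => e; apply/ffunP => i; apply: e; rewrite mem_enum.
Qed.

Lemma induces_standardization pi a s : injective a ->
  induces pi a s = (standardization (fun i => pi (a i)) == s).
Proof.
move=> aI; apply/forallP/eqP => [sE|<- i].
  by apply: standardization_unique => i j; move/forallP: (sE i) => /(_ j)/eqP.
by apply/forallP => j; rewrite standardizationP //; apply: val_perm_inj.
Qed.

Lemma pattern_countE (s : 'S_k) pi : pattern_count s pi =
  #|[set a : {ffun 'I_k -> 'I_n} | increasing a && induces pi a s]|.
Proof.
rewrite /pattern_count -[RHS](card_in_imset (f := @image_of n k)); last first.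
  by move=> a b; rewrite !inE => /andP[ia _] /andP[ib _]; apply: increasing_image_inj.
apply: eq_card => A; rewrite inE; apply/existsP/imsetP => [[a /and3P[ia /eqP -> ind]]|[a]].
  by exists a; rewrite ?inE ?ia.
by rewrite inE => /andP[ia ind] ->; exists a; rewrite ia ind eqxx.
Qed.

Lemma pattern_increasing pi a : increasing a ->
  pattern 1 pi a = standardization (fun i => pi (a i)).
Proof.
move=> ia; rewrite /pattern (_ : standardization _ = 1%g) ?invg1 ?mul1g //.
move: (ia); rewrite (increasing_standardization (increasing_inj ia)) => /eqP <-.
by congr standardization; apply: boolp.funext => i; rewrite perm1.
Qed.

(** Injections with standardization [s] are exactly the [a \o s] with [a] increasing, and [g] does
    not see [s]. *)
Lemma sum_injections (V : nmodType) (g : ('I_k -> 'I_n) -> V) :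
  (forall a (s : 'S_k), injective a -> g (a \o s) = g a) ->
  \sum_(a : {ffun 'I_k -> 'I_n} | injectiveb a) g a =
  (\sum_(a : {ffun 'I_k -> 'I_n} | increasing a) g a) *+ k`!.
Proof.
move=> gs.
rewrite (partition_big (fun a : {ffun 'I_k -> 'I_n} => standardization (fun i => a i)) xpredT) //=.
rewrite -card_Sn -sumr_const; apply: eq_bigr => s _.
pose tw (t : 'S_k) (a : {ffun 'I_k -> 'I_n}) := [ffun i => a (t i)].
have twE t (a : {ffun 'I_k -> 'I_n}) : tw t a = a \o t :> ('I_k -> 'I_n).
  by apply: boolp.funext => i; rewrite ffunE.
rewrite (reindex (tw s)) /=; last first.
  by exists (tw s^-1%g) => a _; apply/ffunP => i; rewrite !ffunE ?permKV ?permK.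
have twI (a : {ffun 'I_k -> 'I_n}) : injectiveb (tw s a) = injectiveb a.
  apply/injectiveP/injectiveP => aI; last first.
    by rewrite twE; apply: inj_comp => //; apply: perm_inj.
  move=> i j ij; apply: (@perm_inj _ s^-1%g); apply: aI.
  by rewrite !ffunE !permKV.
apply: eq_big => [a|a /andP[]]; last first.
  by rewrite twI => /injectiveP aI _; rewrite twE gs.
rewrite twI; case: injectiveP => [aI|aI] /=; last first.
  by apply/esym/negP => /increasing_inj.
have zI : injective (fun i => a i : nat) by move=> i j /val_inj/aI.
rewrite increasing_standardization //.
rewrite -[X in _ = X](inj_eq (mulgI s)) mulg1 -standardization_perm //.
congr (standardization _ == _); apply: boolp.funext => i /=.
by rewrite ffunE.
Qed.

End Increasing.

Section SecondMoment.

Variables (R : realType) (n k : nat) (v : permvec R k).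

(** Summing over injections counts each k-set k! times, but the index set is stable under
    relabelling, unlike that of increasing maps. *)
Definition pattern_total (pi : 'S_n) : R :=
  \sum_(a : {ffun 'I_k -> 'I_n} | injectiveb a) v (pattern 1 pi a).

Lemma inner_profile (pi : 'S_n) :
  inner v (profile R k pi) = pattern_total pi / ('C(n, k) * k`!)%:R.
Proof.
have -> : inner v (profile R k pi) =
    (\sum_(a : {ffun 'I_k -> 'I_n} | increasing a) v (pattern 1 pi a)) / 'C(n, k)%:R.
  rewrite (partition_big (fun a : {ffun 'I_k -> 'I_n} =>
     standardization (fun i => pi (a i))) xpredT) //= mulr_suml.
  apply: eq_bigr => s _; rewrite ffunE /pattern_density mulrA; congr (_ / _).
  rewrite pattern_countE mulr_natr -sumr_const.
  apply: eq_big => [a|a]; last first.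
    rewrite inE => /andP[ia]; rewrite induces_standardization; last exact: increasing_inj.
    by move=> /eqP <-; rewrite pattern_increasing.
  rewrite inE; case ia: (increasing a) => //=.
  by rewrite induces_standardization //; apply: increasing_inj.
rewrite /pattern_total (sum_injections (g := fun a => v (pattern 1 pi a))); last first.
  by move=> a s aI; rewrite pattern_perm.
move: (\sum_(a : {ffun 'I_k -> 'I_n} | increasing a) v (pattern 1 pi a)) => S.
rewrite natrM invfM -[S *+ _]mulr_natr [RHS]mulrA [RHS]mulrAC mulfK //.
by rewrite pnatr_eq0 -lt0n fact_gt0.
Qed.

Lemma pattern_total_relabel (al be : 'S_n) : pattern_total (al^-1 * be)%g =
  \sum_(a : {ffun 'I_k -> 'I_n} | injectiveb a) v (pattern al be a).
Proof.
pose rl (t : 'S_n) (a : {ffun 'I_k -> 'I_n}) := [ffun i => t (a i)].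
have rlE t (a : {ffun 'I_k -> 'I_n}) : rl t a = t \o a :> ('I_k -> 'I_n).
  by apply: boolp.funext => i; rewrite ffunE.
rewrite /pattern_total (reindex (rl al)) /=; last first.
  by exists (rl al^-1%g) => a _; apply/ffunP => i; rewrite !ffunE ?permKV ?permK.
apply: eq_big => [a|a _]; last by rewrite rlE pattern_relabel.
apply/injectiveP/injectiveP => aI i j ij.
  by apply: aI; rewrite rlE /= ij.
by apply: aI; move: ij; rewrite rlE => /perm_inj.
Qed.

(* The number zeta_m of the introductory comment. *)
Definition overlap_moment m : R :=
  pair_sum m (fun x y => v x * v y) / ((k + (k - m))`! ^ 2)%:R.

Lemma second_moment : (0 < k)%N -> (k <= n)%N ->
  unif_expectation (fun pi : 'S_n => inner v (profile R k pi) ^+ 2) =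
  \sum_(m < k.+1) overlap_moment m * ('C(k, m) * 'C(n - k, k - m))%:R / 'C(n, k)%:R.
Proof.
move=> k0 kn; rewrite /unif_expectation card_Sn.
pose W : R := ('C(n, k) * k`!)%:R.
have n0 : (n`!%:R : R) != 0 by rewrite pnatr_eq0 -lt0n fact_gt0.
have k0' : (k`!%:R : R) != 0 by rewrite pnatr_eq0 -lt0n fact_gt0.
have C0 : ('C(n, k)%:R : R) != 0 by rewrite pnatr_eq0 -lt0n bin_gt0.
have W0 : W != 0 by rewrite /W natrM mulf_neq0.
have pairE (a b : {ffun 'I_k -> 'I_n}) : injectiveb a -> injectiveb b ->
    \sum_(al : 'S_n) \sum_(be : 'S_n) v (pattern al be a) * v (pattern al be b) =
    overlap_moment (common_labels a b) * (n`! ^ 2)%:R.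
  move=> /injectiveP aI /injectiveP bI; rewrite /overlap_moment.
  have := sum_pattern_pair (fun x y => v x * v y) k0 aI bI erefl.
  rewrite -[in LHS]mulr_natr -[in RHS]mulr_natr mulrAC => <-; rewrite mulfK //.
  by rewrite pnatr_eq0 -lt0n expn_gt0 fact_gt0.
(* Each [pi] is [al^-1 * be] in n! ways, one for each [al]; this is the factor on the left. *)
have sqE : (\sum_(pi : 'S_n) pattern_total pi ^+ 2) * n`!%:R =
    \sum_(a : {ffun 'I_k -> 'I_n} | injectiveb a)
    \sum_(b : {ffun 'I_k -> 'I_n} | injectiveb b)
      overlap_moment (common_labels a b) * (n`! ^ 2)%:R.
  transitivity (\sum_(al : 'S_n) \sum_(be : 'S_n) pattern_total (al^-1 * be)%g ^+ 2).
    rewrite mulr_natr -card_Sn -sumr_const; apply: eq_bigr => al _.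
    by rewrite [LHS](reindex_inj (mulgI al^-1%g)).
  transitivity (\sum_(al : 'S_n) \sum_(be : 'S_n)
    \sum_(a : {ffun 'I_k -> 'I_n} | injectiveb a)
    \sum_(b : {ffun 'I_k -> 'I_n} | injectiveb b)
      v (pattern al be a) * v (pattern al be b)).
    apply: eq_bigr => al _; apply: eq_bigr => be _.
    rewrite pattern_total_relabel expr2 mulr_suml; apply: eq_bigr => a _.
    by rewrite mulr_sumr.
  under eq_bigr do rewrite exchange_big.
  rewrite exchange_big; apply: eq_bigr => a aI /=.
  under eq_bigr do rewrite exchange_big.
  rewrite exchange_big; apply: eq_bigr => b bI /=.
  exact: pairE.
(* For each of the [W] injections [a], the [b] are grouped by the number of common labels; the class
   sizes do not depend on [a]. *)
have countE : \sum_(a : {ffun 'I_k -> 'I_n} | injectiveb a)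
    \sum_(b : {ffun 'I_k -> 'I_n} | injectiveb b) overlap_moment (common_labels a b) =
    W * \sum_(m < k.+1) overlap_moment m * ('C(k, m) * 'C(n - k, k - m) * k`!)%:R.
  rewrite /W -card_injections mulr_natl -sumr_const.
  rewrite [RHS](eq_bigl (fun a : {ffun 'I_k -> 'I_n} => injectiveb a)); last by move=> a; rewrite inE.
  apply: eq_bigr => a /injectiveP aI.
  pose cl (b : {ffun 'I_k -> 'I_n}) : 'I_k.+1 :=
    Ordinal (common_labels_le a b : (common_labels a b < k.+1)%N).
  rewrite (partition_big cl xpredT) //=; apply: eq_bigr => m _.
  rewrite -(card_injections_overlap aI) ?mulr_natr -?sumr_const; last first.
    by rewrite -ltnS.
  apply: eq_big => [b|b /andP[_ /eqP <-] //].
  by rewrite inE; congr andb; apply/eqP/eqP => [<- //|bm]; apply: val_inj.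
set M := \sum_(m < k.+1) _ in countE.
have SE : \sum_(pi : 'S_n) pattern_total pi ^+ 2 = n`!%:R * W * M.
  apply: (mulIf n0); rewrite sqE.
  under eq_bigr do rewrite -mulr_suml.
  by rewrite -mulr_suml countE natrX expr2; ring.
under eq_bigr do rewrite inner_profile expr_div_n.
rewrite -mulr_suml -/W SE.
have -> : \sum_(m < k.+1) overlap_moment m * ('C(k, m) * 'C(n - k, k - m))%:R /
    'C(n, k)%:R = M / W.
  rewrite /M mulr_suml; apply: eq_bigr => m _.
  by rewrite /W (natrM _ (_ * _)) (natrM _ 'C(n, k)); field; rewrite k0' C0.
by field; rewrite k0' C0 n0.
Qed.

End SecondMoment.
(** * Coset sums of elements of V_r *)

Section Annihilation.

Variables (R : realType) (k : nat).
Local Notation Sk := [set: 'S_k]%G.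
Variables (n : nat) (rho : mx_representation R Sk n).

Definition rep_sum (Y : {set 'I_k}) : 'M[R]_n := \sum_(s in Sym_on Y) rho s.

Lemma repr_permM s t : rho (s * t)%g = rho s *m rho t.
Proof. by rewrite repr_mxM ?inE. Qed.

Lemma rep_sumJ (Y : {set 'I_k}) t :
  rho t *m rep_sum [set t x | x in Y] = rep_sum Y *m rho t.
Proof.
rewrite /rep_sum mulmx_sumr mulmx_suml.
rewrite (reindex_inj (conjg_inj t)) /=.
apply: eq_big => [s|s _]; first by rewrite Sym_onJ.
by rewrite -!repr_permM /conjg !mulgA mulgV mul1g.
Qed.

Lemma rep_sum_absorb Y s : s \in Sym_on Y -> rho s *m rep_sum Y = rep_sum Y.
Proof.
move=> Ys; rewrite /rep_sum mulmx_sumr.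
rewrite [RHS](reindex_inj (mulgI s)) /=.
by apply: eq_big => [t|t _]; rewrite ?groupMl // repr_permM.
Qed.

Variables (lam : seq nat) (T : seq (seq 'I_k)).
Hypotheses (lamP : is_partition k lam) (TP : is_tableau lam T).

Definition row_sum : 'M[R]_n := \sum_(p in row_stab T) rho p.
Definition col_sum : 'M[R]_n := \sum_(q in col_stab T) (-1) ^+ odd_perm q *: rho q.

Lemma tableau_mem x : x \in flatten T.
Proof. by case/andP: TP => _ /perm_mem ->; rewrite mem_enum. Qed.

Lemma has_row x : has (fun s => x \in s) T.
Proof.
by have /flattenP[s sT xs] := tableau_mem x; apply/hasP; exists s.
Qed.

Lemma mem_row x : x \in nth [::] T (row_of T x).
Proof. exact: nth_find (has_row x). Qed.

Lemma size_row i : (size (nth [::] T i) <= head 0 lam)%N.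
Proof.
case/andP: TP => /eqP sh _; case/and3P: lamP => lams _ _.
have -> : size (nth [::] T i) = nth 0%N lam i.
  rewrite -sh.
  case: (ltnP i (size T)) => iT; first by rewrite (nth_map [::]).
  by rewrite !nth_default ?size_map.
move: lams; clear; case: lam => [|l0 l] /= lams; first by rewrite nth_nil.
case: i => //= i; case: (ltnP i (size l)) => [il|]; last by move/(nth_default 0%N)->.
have geq_tr : transitive geq by move=> a b c /= ab bc; apply: leq_trans bc ab.
exact: (allP (order_path_min geq_tr lams)) (mem_nth _ il).
Qed.

Lemma col_of_lt x : (col_of T x < head 0 lam)%N.
Proof. by apply: leq_trans (size_row (row_of T x)); rewrite index_mem mem_row. Qed.

(* A set with more elements than there are columns has two elements in the same
   column; their transposition changes the sign of col_sum and fixes rep_sum. *)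
Lemma col_sum_rep_sum (Y : {set 'I_k}) :
  (head 0 lam < #|Y|)%N -> col_sum *m rep_sum Y = 0.
Proof.
move=> ltY.
have /injectivePn [[x Yx] [[y Yy] nxy cxy]] :
    ~~ injectiveb (fun x : {x | x \in Y} => Ordinal (col_of_lt (val x))).
  apply/negP => /injectiveP /leq_card; rewrite card_ord card_sig.
  by rewrite leqNgt ltY.
have {}cxy : col_of T x = col_of T y by case: cxy.
have {}nxy : x != y by [].
pose t := tperm x y.
have tY : t \in Sym_on Y.
  rewrite inE; apply: fintype.subset_trans (tperm_on x y) _.
  by apply/fintype.subsetP => z; rewrite !inE => /orP[]/eqP->.
have colt z : col_of T (t z) = col_of T z.
  by rewrite /t; case: tpermP => // ->; rewrite cxy.
have Qt : col_sum *m rho t = - col_sum.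
  rewrite /col_sum mulmx_suml -sumrN (reindex_inj (mulIg t)) /=.
  apply: eq_big => [q|q _].
    by rewrite !inE; apply: eq_forallb => z; rewrite permM colt.
  rewrite -scalemxAl -repr_permM -mulgA tperm2 mulg1.
  by rewrite odd_permM odd_tperm nxy signr_addb mulrN1 scaleNr.
have QE : col_sum *m rep_sum Y = - (col_sum *m rep_sum Y).
  by rewrite -{1}(rep_sum_absorb tY) mulmxA Qt mulNmx.
apply/eqP; move/eqP: QE; rewrite -addr_eq0 -mulr2n -scaler_nat scaler_eq0.
by rewrite pnatr_eq0.
Qed.

(** Each [rho (p * g)] from the expanded row sum moves past [rep_sum], replacing [Y] by a translate
    of the same size, which the column sum kills. *)
Lemma symmetrizer_rep_sum (Y : {set 'I_k}) g :
  (head 0 lam < #|Y|)%N -> col_sum *m row_sum *m rho g *m rep_sum Y = 0.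
Proof.
move=> ltY.
have expand Q : Q *m row_sum *m rho g = \sum_(p in row_stab T) Q *m rho (p * g)%g.
  rewrite /row_sum mulmx_sumr mulmx_suml; apply: eq_bigr => p _.
  by rewrite repr_permM mulmxA.
rewrite expand; move: col_sum_rep_sum; move: col_sum => Q QP.
rewrite mulmx_suml big1 // => p _; rewrite -mulmxA.
set h := (p * g)%g.
have -> : Y = [set h x | x in [set (h^-1)%g x | x in Y]].
  rewrite -imset_comp -[LHS]imset_id; apply: eq_imset => x /=; by rewrite permKV.
rewrite rep_sumJ mulmxA QP ?mul0mx //.
by rewrite card_imset //; apply: perm_inj.
Qed.

Definition row0 : {set 'I_k} := [set x | row_of T x == 0%N].

Lemma card_row0 : #|row0| = head 0%N lam.
Proof.
case/andP: (TP) => /eqP sh pT.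
have uT : uniq (flatten T) by rewrite (perm_uniq pT) enum_uniq.
case eT: T => [|s0 T'].
  rewrite eT /= in sh; rewrite -sh /=; apply: eq_card0 => x.
  by have := tableau_mem x; rewrite eT.
have -> : head 0%N lam = size s0 by rewrite -sh eT.
rewrite eT /= cat_uniq in uT; case/and3P: uT => us0 _ _.
rewrite -(card_uniqP us0); apply: eq_card => x.
by rewrite inE /row_of eT /=; case: (x \in s0).
Qed.

Lemma Sym_row0_sub s : s \in Sym_on row0 -> s \in row_stab T.
Proof.
rewrite !inE => sY; apply/forallP => x.
case xY: (x \in row0); last by rewrite (out_perm sY) ?xY.
by have := xY; rewrite -(perm_closed x sY) inE => /eqP->; move: xY; rewrite inE => /eqP->.
Qed.

Lemma row_sum_absorb s : s \in Sym_on row0 -> row_sum *m rho s = row_sum.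
Proof.
move=> /Sym_row0_sub; rewrite inE => /forallP sY.
rewrite /row_sum mulmx_suml [RHS](reindex_inj (mulIg s)) /=.
apply: eq_big => [t|t _]; last by rewrite repr_permM.
rewrite !inE; apply: eq_forallb => x.
by rewrite permM (eqP (sY _)).
Qed.

End Annihilation.

(** * Matrix elements through the Young symmetrizer *)

Section MatrixElements.

Variables (R : realType) (k : nat).
Local Notation Sk := [set: 'S_k]%G.
Local Notation reg := (regular_repr R Sk).

(** The common shape of all matrix elements: [c] holds the coefficients of a group algebra element,
    and [g] enters only to the right of the symmetrizer. *)
Definition matrix_element_of (lam : seq nat) (T : seq (seq 'I_k))
    (c : 'S_k -> R) (e : 'rV[R]_#|Sk|) (b : 'cV[R]_#|Sk|) (g : 'S_k) : R :=
  \sum_h c h * (e *m (col_sum reg T *m row_sum reg T *m reg (h * g)%g) *m b) 0 0.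

Lemma is_matrix_elementE lam (w : permvec R k) : is_matrix_element lam w ->
  exists T c e b, is_tableau lam T /\ forall g, w g = matrix_element_of lam T c e b g.
Proof.
case=> T [d [rG [i [j [TP [B _ /row_freeP[B' BB'] simB] ->]]]]].
set U := cyclic_mx reg (young_symmetrizer R T) in B B' BB' simB.
have modU : mxmodule reg U := cyclic_mx_module reg (young_symmetrizer R T).
set rGT := specht_repr R T in simB.
have specE g : rGT g = val_submod 1%:M *m reg g *m in_submod U 1%:M.
  by rewrite -in_submodE.
(* A row of the embedding lies in the cyclic module, so it is the symmetrizer times some [A], whose
   coefficients are [c]. *)
have [A EA aE] : exists2 A, (A \in enveloping_algebra_mx reg)%MS
    & row i (B *m val_submod 1%:M) = young_symmetrizer R T *m A.
  apply/cyclic_mxP; rewrite row_mul; apply: submx_trans (submxMl _ _) _.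
  exact: val_submodP.
have [c cA] := envelop_mxP EA.
(* [gring_row 1%:M] is the coordinate row of the unit of the group algebra, which turns the matrix
   of the symmetrizer into [young_symmetrizer]. *)
exists T, c, (gring_row 1%:M), (col j (in_submod U 1%:M *m B')); split=> // g.
have rGE : rG g = B *m val_submod 1%:M *m reg g *m (in_submod U 1%:M *m B').
  by rewrite -[LHS]mulmx1 -BB' mulmxA simB ?inE // specE !mulmxA.
rewrite ffunE rGE /matrix_element_of.
set V := in_submod U _ *m B'.
have -> (M : 'M_(d, #|Sk|)) : (M *m V) i j = (row i M *m col j V) 0 0.
  by rewrite !mxE; apply: eq_bigr => l _; rewrite !mxE.
have yE : young_symmetrizer R T =
    gring_row 1%:M *m (col_sum reg T *m row_sum reg T).
  by rewrite -gring_row_mul mul1mx.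
move: (col_sum reg T *m row_sum reg T) yE => QP yE.
rewrite row_mul aE yE cA mulmx_sumr !mulmx_suml summxE.
rewrite (eq_bigl xpredT); last by move=> h; rewrite inE.
apply: eq_bigr => h _.
rewrite -scalemxAr -!scalemxAl mxE; congr (_ * _).
by congr ((_ *m _) _ _); rewrite repr_permM !mulmxA.
Qed.

Variables (lam : seq nat) (T : seq (seq 'I_k)).
Hypotheses (lamP : is_partition k lam) (TP : is_tableau lam T).
Variables (c : 'S_k -> R) (e : 'rV[R]_#|Sk|) (b : 'cV[R]_#|Sk|).
Local Notation w := (matrix_element_of lam T c e b).

(** The sum over [s] places the sum of Sym(Y) to the right of the symmetrizer, which annihilates
    it. *)
Lemma matrix_element_coset_sum (Y : {set 'I_k}) x y :
  (head 0 lam < #|Y|)%N -> \sum_(s in Sym_on Y) w (x * s * y)%g = 0.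
Proof.
move=> ltY; rewrite exchange_big big1 //= => h _.
rewrite -mulr_sumr -summxE -mulmx_suml -mulmx_sumr.
rewrite (eq_bigr (fun s : 'S_k => col_sum reg T *m row_sum reg T *m
    reg (h * x)%g *m reg s *m reg y)); last first.
  by move=> s _; rewrite !repr_permM !mulmxA.
rewrite -mulmx_suml -mulmx_sumr (symmetrizer_rep_sum _ lamP TP) //.
by rewrite mul0mx mulmx0 mul0mx mxE mulr0.
Qed.

(** The row sum absorbs permutations of the first row, so these can be averaged over and then
    shifted onto [v]. *)
Lemma matrix_element_orthogonal (v : 'S_k -> R) :
  (forall x y, \sum_(s in Sym_on (row0 T)) v (x * s * y)%g = 0) ->
  \sum_g v g * w g = 0.
Proof.
move=> v0; pose Y := row0 T.
under eq_bigr do rewrite mulr_sumr.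
rewrite exchange_big big1 //= => h _.
pose S := Sym_on_group Y.
have cardS : (#|S|%:R : R) != 0 by rewrite pnatr_eq0 -lt0n cardG_gt0.
apply: (mulfI cardS); rewrite mulr0.
transitivity (c h * \sum_(s in S) \sum_g v g *
   (e *m (col_sum reg T *m row_sum reg T *m reg (s * (h * g))%g) *m b) 0 0).
  rewrite -sum1_card natr_sum mulr_suml [RHS]mulr_sumr; apply: eq_bigr => s Ss.
  rewrite mul1r [RHS]mulr_sumr; apply: eq_bigr => g _; rewrite mulrCA.
  have PE : row_sum reg T *m reg (s * (h * g))%g = row_sum reg T *m reg (h * g)%g.
    by rewrite (repr_permM _ s) mulmxA (row_sum_absorb _ Ss).
  by rewrite -!(mulmxA (col_sum reg T)) PE.
pose G g := (e *m (col_sum reg T *m row_sum reg T *m reg g) *m b) 0 0.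
(* Substituting [s * h * g] for the variable moves [s] from the matrix element to [v]. *)
rewrite (eq_bigr (fun s => \sum_g v (h^-1 * s^-1 * g)%g * G g)); last first.
  move=> s _; rewrite [RHS](reindex_inj (mulgI (s * h)%g)) /=; apply: eq_bigr => g _.
  by rewrite !mulgA mulgKV mulVg mul1g.
rewrite exchange_big big1 ?mulr0 //= => g _.
rewrite -mulr_suml (reindex_inj invg_inj) /=.
rewrite (eq_bigl [in S]); last by move=> s; rewrite groupV.
under eq_bigr do rewrite invgK.
by rewrite v0 mul0r.
Qed.

End MatrixElements.

(** * Passage from matrix elements to their span *)

Section Vspace.

Variables (R : realType) (k r : nat) (v : permvec R k).
Hypothesis hv : Vspace R k r v.

Lemma Vspace_ind (P : permvec R k -> Prop) :
    P 0 -> (forall a u w, P u -> P w -> P (a *: u + w)) ->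
    (forall lam T c e b (w : permvec R k), is_partition k lam -> head 0%N lam = (k - r)%N ->
       is_tableau lam T ->
       (forall g, w g = matrix_element_of lam T c e b g) -> P w) ->
  P v.
Proof.
move=> P0 PD Pw; case: hv => s [sX /(coord_span (X := in_tuple s)) ->].
have {}sX u : u \in s -> P u.
  move=> /sX [lam [lamP hd /is_matrix_elementE[T [c [e [b [TP wE]]]]]]].
  exact: Pw lamP hd TP wE.
elim/big_rec: _ => // i u _ Pu; apply: PD => //.
by apply: sX; apply: mem_nth.
Qed.

Lemma Vspace_coset_sum (Y : {set 'I_k}) x y :
  (k - r < #|Y|)%N -> \sum_(s in Sym_on Y) v (x * s * y)%g = 0.
Proof.
move=> ltY.
pose P (u : permvec R k) := \sum_(s in Sym_on Y) u (x * s * y)%g = 0.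
apply: (Vspace_ind (P := P)); rewrite {}/P.
- by rewrite big1 // => s _; rewrite ffunE.
- move=> a u1 u2 E1 E2; under eq_bigr do rewrite !ffunE.
  by rewrite big_split /= -scaler_sumr E1 E2 scaler0 addr0.
move=> lam T c e b w lamP hd TP wE.
under eq_bigr do rewrite wE.
by apply: matrix_element_coset_sum => //; rewrite hd.
Qed.

(** Sets of equal size have conjugate symmetric groups, and the conjugating element is absorbed by
    [x] and [y]. *)
Lemma coset_sum_conj (Y Z : {set 'I_k}) : #|Y| = #|Z| ->
  (forall x y, \sum_(s in Sym_on Y) v (x * s * y)%g = 0) ->
  (forall x y, \sum_(s in Sym_on Z) v (x * s * y)%g = 0).
Proof.
move=> cYZ vY x y.
have [t ->] := exists_perm_imset cYZ.
rewrite (reindex_inj (conjg_inj t)) /=.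
rewrite (eq_bigl [in Sym_on Y]); last by move=> s; rewrite Sym_onJ.
rewrite -[RHS](vY (x * t^-1)%g (t * y)%g); apply: eq_bigr => s _.
by rewrite /conjg !mulgA.
Qed.

(** The first row of each tableau has [k - r] cells, so [v] is orthogonal to all generators, hence
    to itself. *)
Lemma Vspace_eq0 (Y : {set 'I_k}) : #|Y| = (k - r)%N ->
  (forall x y, \sum_(s in Sym_on Y) v (x * s * y)%g = 0) -> v = 0.
Proof.
move=> cY v0.
have : \sum_g v g * v g = 0.
  pose P (u : permvec R k) := \sum_g v g * u g = 0.
  apply: (Vspace_ind (P := P)); rewrite {}/P.
  - by rewrite big1 // => s _; rewrite ffunE mulr0.
  - move=> a u1 u2 E1 E2; under eq_bigr do rewrite !ffunE mulrDr -scalerAr.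
    by rewrite big_split /= -scaler_sumr E1 E2 scaler0 addr0.
  move=> lam T c e b w lamP hd TP wE.
  under eq_bigr do rewrite wE.
  apply: matrix_element_orthogonal => //; apply: coset_sum_conj v0.
  by rewrite (card_row0 TP) hd.
move/eqP; rewrite psumr_eq0 => [/allP H|g _]; last by rewrite -expr2 sqr_ge0.
by apply/ffunP => g; apply/eqP; have := H g (mem_index_enum g);
  rewrite mulf_eq0 orbb ffunE.
Qed.

End Vspace.
(** * Asymptotics *)

Section Asymptotics.

Variable R : realType.

Lemma cvg_sum_ord K (F : 'I_K -> nat -> R) (l : 'I_K -> R) :
  (forall m, (F m n @[n --> \oo] --> l m)%classic) ->
  ((\sum_m F m n) @[n --> \oo] --> \sum_m l m)%classic.
Proof.
elim: K F l => [|K IH] F l Fl.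
  rewrite big_ord0; under boolp.eq_fun do rewrite big_ord0; exact: cvg_cst.
rewrite big_ord_recr; under boolp.eq_fun do rewrite big_ord_recr.
by apply: cvgD => //; apply: IH.
Qed.

Lemma cvg_invn : ((n%:R : R)^-1 @[n --> \oo] --> (0 : R))%classic.
Proof.
apply/gtr0_cvgV0; last exact: cvgr_idn.
by near=> n; rewrite ltr0n; near: n; exact: nbhs_infty_gt.
Unshelve. all: by end_near. Qed.

Lemma cvg_invnX d : (((n%:R : R)^-1 ^+ d.+1) @[n --> \oo] --> (0 : R))%classic.
Proof.
elim: d => [|d IH]; first by under boolp.eq_fun do rewrite expr1; exact: cvg_invn.
under boolp.eq_fun do rewrite exprS.
have lim := cvgM cvg_invn IH; rewrite mulr0 in lim; exact: lim.
Qed.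

Lemma cvg_ffact_ratio c j :
  (((n - c) ^_ j)%:R / n%:R ^+ j @[n --> \oo] --> (1 : R))%classic.
Proof.
elim: j => [|j IH].
  under boolp.eq_fun do rewrite ffactn0 expr0 divr1; exact: cvg_cst.
(* Passing from [j] to [j.+1] contributes the factor (n - c - j) / n. *)
have lim : (((n - c) ^_ j)%:R / n%:R ^+ j * (1 - (c + j)%:R * (n%:R : R)^-1)
    @[n --> \oo] --> 1 * (1 - (c + j)%:R * (0 : R)))%classic.
  apply: cvgM => //; apply: cvgB; first exact: cvg_cst.
  by apply: cvgM; [exact: cvg_cst | exact: cvg_invn].
rewrite mulr0 subr0 mulr1 in lim.
apply: cvg_trans lim; apply: near_eq_cvg; near=> n.
have n0 : (n%:R : R) != 0.
  by rewrite pnatr_eq0 -lt0n; near: n; exact: nbhs_infty_gt.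
have cjn : (c + j <= n)%N by near: n; exact: nbhs_infty_ge.
rewrite ffactnSr natrM -subnDA natrB // exprSr.
by field; rewrite n0 expf_neq0.
Unshelve. all: by end_near. Qed.

(** Both binomials are falling factorials over factorials, and the powers of [n] cancel since k = m
    + (k - m). *)
Lemma cvg_bin_ratio k m : (m <= k)%N ->
  (n%:R ^+ m * ('C(n - k, k - m)%:R / 'C(n, k)%:R) @[n --> \oo] -->
     (k`!%:R / (k - m)`!%:R : R))%classic.
Proof.
move=> mk.
have lim : (k`!%:R / (k - m)`!%:R * (((n - k) ^_ (k - m))%:R / n%:R ^+ (k - m) *
    (((n - 0) ^_ k)%:R / n%:R ^+ k)^-1) @[n --> \oo] -->
    k`!%:R / (k - m)`!%:R * (1 * (1 : R)^-1))%classic.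
  apply: cvgM; first exact: cvg_cst.
  apply: cvgM; first exact: cvg_ffact_ratio.
  by apply: cvgV; [exact: oner_neq0 | exact: cvg_ffact_ratio].
rewrite invr1 !mulr1 in lim.
apply: cvg_trans lim; apply: near_eq_cvg; near=> n.
have n0 : (n%:R : R) != 0.
  by rewrite pnatr_eq0 -lt0n; near: n; exact: nbhs_infty_gt.
have kn : (k <= n)%N by near: n; exact: nbhs_infty_ge.
have fact0 j : (j`!%:R : R) != 0 by rewrite pnatr_eq0 -lt0n fact_gt0.
have C0 : ('C(n, k)%:R : R) != 0 by rewrite pnatr_eq0 -lt0n bin_gt0.
have nk : (n%:R : R) ^+ k = n%:R ^+ m * n%:R ^+ (k - m) by rewrite -exprD subnKC.
rewrite subn0 -!bin_ffact !natrM nk.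
by field; rewrite !expf_neq0 ?C0 ?fact0.
Unshelve. all: by end_near. Qed.

End Asymptotics.

(** * Extraction of the leading term *)

Theorem theorem1 (R : realType) (k r : nat) (hk : (1 <= k)%N) (hr : (r < k)%N)
    (v : permvec R k) (hv : Vspace R k r v) (hv0 : v <> 0) :
  exists C : R, 0 < C /\
    asymp_equiv
      (fun n : nat => unif_expectation
         (fun pi : 'S_n => inner v (profile R k pi) ^+ 2))
      (fun n : nat => C / n%:R ^+ r).
Proof.
have N_gt0 m : 0 < ((k + (k - m))`! ^ 2)%:R :> R by rewrite ltr0n expn_gt0 fact_gt0.
have moment0 m : (m < r)%N -> overlap_moment v m = 0.
  move=> mr; have mk : (m <= k)%N by apply: ltnW (ltn_trans mr hr).
  rewrite /overlap_moment pair_sum_eq0 ?mul0r // => x y.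
  by apply: (Vspace_coset_sum hv); rewrite card_top_set // ltn_sub2l // (ltn_trans mr).
have moment_gt0 : 0 < overlap_moment v r.
  apply: divr_gt0 => //.
  have [[x [y xy]]|none] := boolp.pselect (exists x y,
    \sum_(s in Sym_on (top_set k r)) v (x * s * y)%g != 0).
    by apply: pair_sum_gt0 xy; rewrite ltnW.
  case: hv0; apply: (Vspace_eq0 hv (card_top_set (ltnW hr))) => x y.
  by apply/eqP; apply: boolp.contrapT => xy; apply: none; exists x, y; apply/negP.
(* The limit of n^r times the term [m = r] of the exact formula. *)
pose C : R := overlap_moment v r * 'C(k, r)%:R * (k`!%:R / (k - r)`!%:R).
have C0 : 0 < C.
  apply: mulr_gt0; last by apply: divr_gt0; rewrite ltr0n fact_gt0.
  by apply: mulr_gt0 => //; rewrite ltr0n bin_gt0 ltnW.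
exists C; split=> //; rewrite /asymp_equiv.
pose q m n : R := 'C(n - k, k - m)%:R / 'C(n, k)%:R.
(* After multiplication by n^r, terms with [m < r] vanish, the term [m = r] tends to [C], and those
   with [m > r] retain n^(r-m). *)
have lim : ((C^-1 * \sum_(m < k.+1) overlap_moment v m * 'C(k, m)%:R * (n%:R ^+ r * q m n))
   @[n --> \oo] --> C^-1 * \sum_(m < k.+1) (if m == r :> nat then C else 0))%classic.
  apply: cvgM; first exact: cvg_cst.
  apply: cvg_sum_ord => m; have mk : (m <= k)%N by rewrite -ltnS.
  case: (ltngtP m r) => [mr|rm|mr].
  - rewrite moment0 // mul0r; under boolp.eq_fun do rewrite mul0r; exact: cvg_cst.
  - have lim0 : (overlap_moment v m * 'C(k, m)%:R *
        ((n%:R : R)^-1 ^+ (m - r) * (n%:R ^+ m * q m n)) @[n --> \oo] -->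
        overlap_moment v m * 'C(k, m)%:R * (0 * (k`!%:R / (k - m)`!%:R)))%classic.
      apply: cvgM; first exact: cvg_cst.
      apply: cvgM; last exact: cvg_bin_ratio.
      by rewrite -(@prednK (m - r)) ?subn_gt0 //; exact: cvg_invnX.
    rewrite mul0r mulr0 in lim0; apply: cvg_trans lim0.
    apply: near_eq_cvg; near=> n.
    have n0 : (n%:R : R) != 0.
      by rewrite pnatr_eq0 -lt0n; near: n; exact: nbhs_infty_gt.
    congr (_ * _); rewrite -[X in _ * (_ ^+ X * _)](subnKC (ltnW rm)) exprD exprVn.
    by field; rewrite expf_neq0.
  rewrite /C mr; apply: cvgM; first exact: cvg_cst.
  by rewrite -mr; apply: cvg_bin_ratio.
have sumC : C^-1 * \sum_(m < k.+1) (if m == r :> nat then C else 0) = 1.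
  have rk : (r < k.+1)%N by rewrite ltnS ltnW.
  rewrite (bigD1 (Ordinal rk)) //= eqxx big1 ?addr0 ?mulVf ?gt_eqF // => m mr.
  by rewrite ifN.
clearbody C; rewrite sumC in lim; apply: cvg_trans lim; apply: near_eq_cvg; near=> n.
have kn : (k <= n)%N by near: n; exact: nbhs_infty_ge.
rewrite second_moment // invfM invrK [RHS]mulrC -mulrA; congr (_ * _).
rewrite mulr_sumr; apply: eq_bigr => m _.
by rewrite /q natrM; ring.
Unshelve. all: by end_near. Qed.
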